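(* Let $F$ be a field of characteristic zero with a derivation $\delta$ whose field of constants $F^\delta=\{x\in F\mid \delta x=0\}$ is algebraically closed. Let $n\ge 1$, let $F(Y):=F(y_1,\dots,y_n)$ be the rational function field in $n$ variables over $F$, and let $f_0\in F$, $f_1\in F[y_1]$, $\dots$, $f_{n-1}\in F[y_1,\dots,y_{n-1}]$. Extend $\delta$ to $F(Y)$ by $$\delta:=\delta_0+f_0\delta_1+f_1\delta_2+\cdots+f_{n-1}\delta_n ,$$ where $\delta_0,\dots,\delta_n$ are the derivations of $F(Y)$ described in the context; thus $\delta y_1=f_0,\ \delta y_2=f_1,\ \dots,\ \delta y_n=f_{n-1}$. Suppose that $F(Y)^\delta=F^\delta$. Then the system $$\delta y_1=f_0,\quad \delta y_2=f_1,\quad \dots,\quad \delta y_n=f_{n-1}$$ admits an elementary first $\delta$-integral if and only if there is an elementary $\delta$-integral $u\in F(Y)$ of $F$ with $u\notin F$.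
   Context: Derivations on $F(Y)$: $\Delta=\{\delta_0,\delta_1,\dots,\delta_n\}$ is the set of derivations of $F(Y)$ given as follows: $\delta_0 x=\delta x$ for all $x\in F$ and $\delta_0 y_j=0$ for all $1\le j\le n$; for $1\le i\le n$, $\delta_i x=0$ for all $x\in F$, $\delta_i y_j=0$ if $j\ne i$, and $\delta_i y_i=1$. The derivation $\delta=\delta_0+f_0\delta_1+\cdots+f_{n-1}\delta_n$ of $F(Y)$ restricts to the given derivation on $F$. For a field $K$ on which these derivations act, $K^\Delta=\{x\in K\mid \delta_i x=0 \text{ for all } i=0,\dots,n\}$ and $K^\delta=\{x\in K\mid \delta x=0\}$. Elementary $\Delta$-extension: a field extension $E$ of $F(Y)$ is an elementary $\Delta$-extension of $F(Y)$ if each $\delta_i\in\Delta$ can be extended to a derivation of $E$ (still denoted $\delta_i$) such that $E^\Delta=F(Y)^\Delta$ and there are $t_1,\dots,t_m\in E$ with $E=F(Y)(t_1,\dots,t_m)$ such that for each $j=1,\dots,m$ there is an element $a_j\in F(Y)(t_1,\dots,t_{j-1})$ for which one of the following holds: (i) $t_j$ is algebraic over $F(Y)(t_1,\dots,t_{j-1})$; (ii) $\delta_i t_j=(\delta_i a_j)t_j$ for all $i=0,1,\dots,n$; (iii) $a_j\neq 0$ and $\delta_i t_j=\frac{\delta_i a_j}{a_j}$ for all $i=0,1,\dots,n$. The derivation $\delta$ is extended to $E$ by the same formula $\delta=\delta_0+f_0\delta_1+\cdots+f_{n-1}\delta_n$. Elementary first $\delta$-integral: an elementary first $\delta$-integral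 of the system $\delta y_1=f_0,\dots,\delta y_n=f_{n-1}$ is an element $e\in E^\delta$ with $e\notin F^\delta$, where $E$ is some elementary $\Delta$-extension of $F(Y)$. Elementary $\delta$-integral: an element $u\in F(Y)$ is an elementary $\delta$-integral of $F$ if $F(Y)^\delta=F^\delta$, $\delta u\in F$, and there are an element $v_0\in F$, finitely many nonzero elements $v_1,\dots,v_m\in F$ and constants $c_1,\dots,c_m\in F^\delta$ such that $\delta u=c_1\frac{\delta v_1}{v_1}+\cdots+c_m\frac{\delta v_m}{v_m}+\delta v_0$. *)

(* Defs.v *)
From HB Require Import structures.
From mathcomp Require Import all_boot all_order all_algebra generic_quotient.
From mathcomp Require Import fraction mpoly ring.

Set Implicit Arguments.
Unset Strict Implicit.
Unset Printing Implicit Defensive.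

Import GRing.Theory.
Local Open Scope ring_scope.
Local Open Scope quotient_scope.

Definition derivation (R : pzRingType) (d : R -> R) : Prop :=
  (forall x y, d (x + y) = d x + d y) /\
  (forall x y, d (x * y) = d x * y + x * d y).

Definition is_const (R : pzRingType) (d : R -> R) (x : R) : Prop := d x = 0.

Definition common_const (I : Type) (R : pzRingType) (D : I -> R -> R) (x : R)
  : Prop := forall i, D i x = 0.

(* The subset B of L is the image of the subset A of K. *)
Definition same_set (K L : Type) (iota : K -> L) (A : K -> Prop) (B : L -> Prop)
  : Prop := forall x, B x <-> exists2 z, A z & x = iota z.

(* Every nonconstant polynomial over the field of constants has a root there. *)
Definition const_closed (F : fieldType) (delta : F -> F) : Prop :=
  forall p : {poly F}, (1 < size p)%N -> (forall i, is_const delta p`_i) ->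
  exists2 x, is_const delta x & root p x.

Notation ratfun F n := {fraction {mpoly F[n]}}.

Definition ratC (F : fieldType) (n : nat) (c : F) : ratfun F n :=
  tofrac c%:MP_[n].

Definition ratX (F : fieldType) (n : nat) (j : 'I_n) : ratfun F n :=
  tofrac ('X_j : {mpoly F[n]}).

(* Indices are shifted: y_1, ..., y_n are 'X_0, ..., 'X_(n-1), so that
   delta_i, for 1 <= i <= n, is D (lift ord0 i') with i' = i - 1. *)
Definition Delta_spec (F : fieldType) (delta : F -> F) (n : nat)
    (D : 'I_n.+1 -> ratfun F n -> ratfun F n) : Prop :=
  [/\ forall i, derivation (D i),
      forall c, D ord0 (ratC n c) = ratC n (delta c),
      forall j, D ord0 (ratX F j) = 0,
      forall (i : 'I_n) c, D (lift ord0 i) (ratC n c) = 0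
    & forall i j : 'I_n, D (lift ord0 i) (ratX F j) = (j == i)%:R].

(* p belongs to F[y_1, ..., y_k]. *)
Definition in_first_vars (F : fieldType) (n k : nat) (p : {mpoly F[n]}) : Prop :=
  forall m, m \in msupp p -> forall j : 'I_n, (k <= j)%N -> m j = 0%N.

(* delta_0 + f_0 delta_1 + ... + f_(n-1) delta_n on an extension E of F(Y)
   on which the delta_i act through d. *)
Definition total_derivation (F : fieldType) (n : nat) (f : 'I_n -> {mpoly F[n]})
    (E : fieldType) (iota : ratfun F n -> E) (d : 'I_n.+1 -> E -> E) (x : E) : E :=
  d ord0 x + \sum_(i < n) iota (tofrac (f i)) * d (lift ord0 i) x.

(* The subfield K(ts) of E. *)
Inductive adjoin (K E : fieldType) (iota : K -> E) (ts : seq E) : E -> Prop :=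
| adjoin_base z : adjoin iota ts (iota z)
| adjoin_gen t : t \in ts -> adjoin iota ts t
| adjoin_add x y : adjoin iota ts x -> adjoin iota ts y -> adjoin iota ts (x + y)
| adjoin_opp x : adjoin iota ts x -> adjoin iota ts (- x)
| adjoin_mul x y : adjoin iota ts x -> adjoin iota ts y -> adjoin iota ts (x * y)
| adjoin_inv x : adjoin iota ts x -> adjoin iota ts x^-1.

Definition algebraic_over (E : fieldType) (S : E -> Prop) (x : E) : Prop :=
  exists p : {poly E}, [/\ p != 0, forall i, S p`_i & root p x].

Definition elementary_step (I : Type) (E : fieldType) (d : I -> E -> E)
    (S : E -> Prop) (t : E) : Prop :=
  exists2 a, S a &
  [\/ algebraic_over S t,
      forall i, d i t = d i a * t
    | a != 0 /\ forall i, d i t = d i a / a].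

Definition elementary_extension (I : Type) (K : fieldType) (D : I -> K -> K)
    (E : fieldType) (iota : {rmorphism K -> E}) (d : I -> E -> E) : Prop :=
  [/\ forall i, derivation (d i),
      forall i z, d i (iota z) = iota (D i z),
      same_set iota (common_const D) (common_const d)
    & exists ts : seq E,
        (forall x, adjoin iota ts x) /\
        (forall j, (j < size ts)%N ->
           elementary_step d (adjoin iota (take j ts)) ts`_j)].

Definition elementary_first_integral (F : fieldType) (delta : F -> F) (n : nat)
    (D : 'I_n.+1 -> ratfun F n -> ratfun F n) (f : 'I_n -> {mpoly F[n]}) : Prop :=
  exists (E : fieldType) (iota : {rmorphism ratfun F n -> E})
         (d : 'I_n.+1 -> E -> E),
    elementary_extension D iota d /\
    exists e : E,
      is_const (total_derivation f iota d) e /\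
      ~ (exists2 c, is_const delta c & e = iota (ratC n c)).

(* F(Y)^delta = F^delta *)
Definition no_new_const (F : fieldType) (delta : F -> F) (n : nat)
    (D : 'I_n.+1 -> ratfun F n -> ratfun F n) (f : 'I_n -> {mpoly F[n]}) : Prop :=
  same_set (@ratC F n) (is_const delta) (is_const (total_derivation f id D)).

Definition elementary_integral (F : fieldType) (delta : F -> F) (n : nat)
    (D : 'I_n.+1 -> ratfun F n -> ratfun F n) (f : 'I_n -> {mpoly F[n]})
    (u : ratfun F n) : Prop :=
  no_new_const delta D f /\
  exists2 w : F, total_derivation f id D u = ratC n w &
  exists (v0 : F) (m : nat) (v c : 'I_m -> F),
    [/\ forall i, v i != 0,
        forall i, is_const delta (c i)
      & w = \sum_(i < m) c i * (delta (v i) / v i) + delta v0].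

Lemma fracE (R : idomainType) (z : {fraction R}) :
  exists p q : R, q != 0 /\ z = tofrac p / tofrac q.
Proof.
elim/quotW: z => r; exists r.1, r.2; split; first exact: denom_ratioP.
apply: (canRL (mulfK _)); first by rewrite tofrac_eq0 denom_ratioP.
rewrite /GRing.mul /= !piE; apply/eqmodP => /=.
rewrite FracField.equivfE /FracField.mulf !numden_Ratio ?mulf_neq0 ?oner_neq0 ?denom_ratioP //.
by rewrite !mulr1 mulrC.
Qed.

Lemma aux_wd (R : comPzRingType) (a b c f a' b' c' f' : R) :
  a * f = c * b -> a' * f + a * f' = c' * b + c * b' ->
  (a' * b - a * b') * f ^+ 2 = (c' * f - c * f') * b ^+ 2.
Proof.
move=> e de; apply/eqP; rewrite -subr_eq0; apply/eqP.
transitivity (b * f * ((a' * f + a * f') - (c' * b + c * b'))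
                - (b * f' + f * b') * (a * f - c * b)); first by ring.
by rewrite de e !subrr !mulr0 subr0.
Qed.

Lemma aux_add (K : fieldType) (a b c f a' b' c' f' : K) : b != 0 -> f != 0 ->
  ((a' * f + a * f' + (c' * b + c * b')) * (b * f)
     - (a * f + c * b) * (b' * f + b * f')) / (b * f) ^+ 2 =
  (a' * b - a * b') / b ^+ 2 + (c' * f - c * f') / f ^+ 2.
Proof. by move=> b0 f0; field; rewrite b0 f0. Qed.

Lemma aux_mul (K : fieldType) (a b c f a' b' c' f' : K) : b != 0 -> f != 0 ->
  ((a' * c + a * c') * (b * f) - (a * c) * (b' * f + b * f')) / (b * f) ^+ 2 =
  (a' * b - a * b') / b ^+ 2 * (c / f) + a / b * ((c' * f - c * f') / f ^+ 2).
Proof. by move=> b0 f0; field; rewrite b0 f0. Qed.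

Lemma derivation_frac (R : idomainType) (d : R -> R) : derivation d ->
  exists2 D : {fraction R} -> {fraction R},
    derivation D & forall p, D (tofrac p) = tofrac (d p).
Proof.
move=> [dD dM].
pose G (p q : R) : {fraction R} :=
  (tofrac (d p) * tofrac q - tofrac p * tofrac (d q)) / tofrac q ^+ 2.
have Gwd p q p' q' : q != 0 -> q' != 0 ->
    tofrac p / tofrac q = tofrac p' / tofrac q' -> G p q = G p' q'.
  move=> q0 q0'; have Q0 : tofrac q != 0 by rewrite tofrac_eq0.
  have Q0' : tofrac q' != 0 by rewrite tofrac_eq0.
  move=> /eqP; rewrite eqr_div // -!tofracM tofrac_eq => /eqP e.
  have de : d p * q' + p * d q' = d p' * q + p' * d q by rewrite -!dM e.
  apply/eqP; rewrite eqr_div ?expf_neq0 //; apply/eqP; apply: aux_wd.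
    by rewrite -!tofracM e.
  by rewrite -!tofracM -!tofracD de.
have ex z : exists pq : R * R, (pq.2 != 0) && (z == tofrac pq.1 / tofrac pq.2).
  by have [p [q [q0 ->]]] := fracE z; exists (p, q); rewrite q0 eqxx.
pose D z := G (xchoose (ex z)).1 (xchoose (ex z)).2.
have DE p q : q != 0 -> D (tofrac p / tofrac q) = G p q.
  move=> q0; have /andP[q1 /eqP e] := xchooseP (ex (tofrac p / tofrac q)).
  by apply: Gwd => //; rewrite -e.
exists D; last first.
  move=> p; have d1 : d 1 = 0.
    by apply: (addrI (d 1)); rewrite addr0 -{3}[1]mulr1 dM mul1r mulr1.
  have := DE p 1 (oner_neq0 _).
  by rewrite /G d1 tofrac1 tofrac0 divr1 mulr0 subr0 mulr1 expr1n divr1.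
split=> x y; have [p [q [q0 ->]]] := fracE x; have [u [v [v0 ->]]] := fracE y.
  have Q0 : tofrac q != 0 by rewrite tofrac_eq0.
  have V0 : tofrac v != 0 by rewrite tofrac_eq0.
  rewrite addf_div // -!tofracM -tofracD !DE ?mulf_neq0 // /G.
  rewrite !(dD, dM, tofracD, tofracM).
  exact: aux_add.
have Q0 : tofrac q != 0 by rewrite tofrac_eq0.
have V0 : tofrac v != 0 by rewrite tofrac_eq0.
rewrite mulf_div -!tofracM !DE ?mulf_neq0 // /G !(dD, dM, tofracD, tofracM).
exact: aux_mul.
Qed.

Lemma derivation_sum (R : pzRingType) (d : R -> R) : derivation d ->
  forall (I : Type) (r : seq I) (P : pred I) (G : I -> R),
  d (\sum_(i <- r | P i) G i) = \sum_(i <- r | P i) d (G i).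
Proof.
move=> [dD _] I r P G; apply: (big_morph d dD).
by apply: (addrI (d 0)); rewrite -dD !addr0.
Qed.

Lemma derivation_mpoly (F : fieldType) (delta : F -> F) (n : nat) :
  derivation delta ->
  exists2 d : {mpoly F[n]} -> {mpoly F[n]},
    derivation d & (forall c, d c%:MP = (delta c)%:MP) /\ (forall j, d 'X_j = 0).
Proof.
move=> dder; have [dD dM] := dder.
have d0 : delta 0 = 0 by apply: (addrI (delta 0)); rewrite -dD !addr0.
have d1 : delta 1 = 0.
  by apply: (addrI (delta 1)); rewrite addr0 -{3}[1]mulr1 dM mul1r mulr1.
have dB : zmod_morphism delta.
  move=> x y; rewrite dD; congr (_ + _); apply: (addrI (delta y)).
  by rewrite -dD !subrr.
pose da : {additive F -> F} :=
  HB.pack delta (GRing.isZmodMorphism.Build F F delta dB).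
have cE p m : (map_mpoly delta p : {mpoly F[n]})@_m = delta p@_m.
  exact: (mcoeff_map_mpoly da).
exists (map_mpoly delta); [split|split].
- by move=> x y; apply/mpolyP => m; rewrite !(mcoeffD, cE) dD.
- move=> p q; apply/mpolyP => m.
  rewrite cE mcoeffD !mcoeffM derivation_sum // -big_split /=.
  by apply: eq_bigr => k _; rewrite dM !cE.
- by move=> c; apply/mpolyP => m; rewrite cE !mcoeffC; case: eqP; rewrite ?mulr1 ?mulr0.
- move=> j; apply/mpolyP => m; rewrite cE mcoeffX mcoeff0.
  by case: eqP.
Qed.

(* Delta_spec is satisfiable; it determines D since F and the y_j generate
   F(Y) as a field. *)
Lemma Delta_exists (F : fieldType) (delta : F -> F) (n : nat) :
  derivation delta -> exists D, Delta_spec delta (n := n) D.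
Proof.
move=> /(derivation_mpoly n)[d0 /derivation_frac[D0 D0der D0E] [d0C d0X]].
have ex (i : 'I_n) : exists D : ratfun F n -> ratfun F n,
    derivation D /\ forall p, D (tofrac p) = tofrac p^`M(i).
  have [|D] := @derivation_frac {mpoly F[n]} (mderiv i); last by exists D.
  by split=> p q; [exact: mderivD | exact: mderivM].
have [D DP] : exists D : 'I_n -> ratfun F n -> ratfun F n, forall i,
    derivation (D i) /\ forall p, D i (tofrac p) = tofrac p^`M(i).
  have [s sz sP] : exists2 s : seq (ratfun F n -> ratfun F n), size s = n &
      forall i : 'I_n, derivation (nth id s i) /\
        forall p, nth id s i (tofrac p) = tofrac p^`M(i).
    suff H k : (k <= n)%N -> exists2 s : seq (ratfun F n -> ratfun F n),
        size s = k & forall i : 'I_n, (i < k)%N -> derivation (nth id s i) /\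
        forall p, nth id s i (tofrac p) = tofrac p^`M(i).
      by have [s ? sP] := H n (leqnn n); exists s => // i; apply: sP.
    elim: k => [|k IH] lt_kn; first by exists [::].
    have [s sz sP] := IH (ltnW lt_kn); have [D DP] := ex (Ordinal lt_kn).
    exists (rcons s D) => [|i]; first by rewrite size_rcons sz.
    rewrite ltnS leq_eqVlt nth_rcons sz => /orP[/eqP e|lt_ik]; last first.
      by rewrite lt_ik; apply: sP.
    by rewrite e ltnn eqxx; have -> : i = Ordinal lt_kn by apply: val_inj.
  by exists (fun i => nth id s i).
exists (fun i => if unlift ord0 i is Some j then D j else D0); split.
- by move=> i; case: (unlift ord0 i) => [j|//]; have [] := DP j.
- by move=> c; rewrite unlift_none D0E d0C.
- by move=> j; rewrite unlift_none D0E d0X tofrac0.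
- by move=> i c; rewrite liftK (DP i).2 mderivC tofrac0.
move=> i j; rewrite liftK (DP i).2 mderivX mnm1E eq_sym.
have [->|] := eqVneq i j; last by rewrite scale0r tofrac0.
rewrite scale1r (_ : (U_(j) - U_(j))%MM = 0%MM) ?mpolyX0 ?tofrac1 //.
by apply/mnmP => k; rewrite mnmBE mnm0E subnn.
Qed.

(* Main.v *)
(* A constant e of delta in an elementary extension E of F(Y) that is not in
   F^delta is traded for a formal first integral v + sum_k c_k log w_k: a
   differential form dv + sum_k c_k dw_k / w_k, with c_k in F^delta, that is
   killed by delta but not by every delta_i.  The first level K(t) of the tower
   that acquires a new constant x provides one with v and the w_k in K, since t
   is algebraic over K(x) and traces to K(x) are available.

   The form is then pushed down the tower, its v and w_k being algebraic over
   the current level.  If t is transcendental over K, the derivation d/dt (for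
   a logarithm) or t d/dt (for an exponential) extends to algebraic extensions
   of K(t) and commutes with delta, hence sends v + sum c_k log w_k to a
   constant h; comparing degrees in K(w_k), after a norm, shows that up to
   h t, or h log t, the w_k and v may be taken algebraic over K, without
   changing the form.  The same step goes down F(y_1, ..., y_l), and since the
   form is not zero some y_l must appear: N delta y_l = delta V + sum c_k
   delta W_k / W_k over F(y_1, ..., y_(l-1)).  Taking polynomial parts in
   y_(l-1), ..., y_1 brings the W_k into F and turns V into a polynomial G plus
   an element of F, and u = N y_l - G.

   Conversely the logarithms of the v_k are adjoined one at a time without new
   constants, and u - sum c_k log v_k - v_0 is a first integral. *)

Require Import Defs.
From HB Require Import structures.
From mathcomp Require Import all_boot all_order all_algebra.
From mathcomp Require Import fraction mpoly perm polyXY ring zify.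
From Stdlib Require Import Classical ClassicalEpsilon.

Set Implicit Arguments.
Unset Strict Implicit.
Unset Printing Implicit Defensive.

Import GRing.Theory.
Local Open Scope ring_scope.

(** * Subfields and algebraic elements *)

(** The form has to be carried unchanged through the descent. Its v and w_k are only algebraic over
    the current level, so they have no degree in t; a norm would restore degrees, but the
    corresponding trace can annihilate a nonzero form (a square root has trace 0). During the
    descent norms therefore serve only to find integer relations among the c_k, and these relations
    regroup the logarithms as power products without altering the form. A trace is applied to a
    relation itself only at the two ends, where nontriviality is checked afresh: from the
    transcendence of t at the top, from the term N y_l at the bottom.

    The quantity h must be admissible as a coefficient of a form, that is, lie in F^delta. This is
    where algebraic closedness enters: together with F(Y)^delta = F^delta it puts every constant
    algebraic over F(Y) into F^delta. Starting from the lowest level that acquires a constant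
    preserves this property at all levels of the descent. Only the quotients dw/w occur, so the
    logarithms of the w_k need not exist in E. *)

Record subfield (E : fieldType) (S : E -> Prop) : Prop := Subfield {
  subfield1 : S 1;
  subfieldB : forall x y, S x -> S y -> S (x - y);
  subfieldM : forall x y, S x -> S y -> S (x * y);
  subfieldV : forall x, S x -> S x^-1 }.

Section SubfieldTheory.

Variables (E : fieldType) (S : E -> Prop) (sfS : subfield S).

Lemma subfield0 : S 0.
Proof. by rewrite -(subrr 1); apply: (subfieldB sfS); apply: (subfield1 sfS). Qed.

Lemma subfieldN x : S x -> S (- x).
Proof. by move=> Sx; rewrite -[- x]add0r; apply: (subfieldB sfS subfield0 Sx). Qed.

Lemma subfieldD x y : S x -> S y -> S (x + y).
Proof. by move=> Sx /subfieldN Sy; rewrite -[y]opprK; apply: (subfieldB sfS). Qed.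

Lemma subfield_div x y : S x -> S y -> S (x / y).
Proof. by move=> Sx /(subfieldV sfS); apply: (subfieldM sfS). Qed.

Lemma subfieldX x n : S x -> S (x ^+ n).
Proof.
move=> Sx; elim: n => [|n IH]; first by rewrite expr0; apply: (subfield1 sfS).
by rewrite exprS; apply: (subfieldM sfS).
Qed.

Lemma subfield_sum (I : Type) (r : seq I) (P : pred I) (G : I -> E) :
  (forall i, P i -> S (G i)) -> S (\sum_(i <- r | P i) G i).
Proof. by move=> SG; elim/big_rec: _ => [|i x Pi]; [exact: subfield0|apply: subfieldD;
  auto]. Qed.

Lemma subfield_nat n : S n%:R.
Proof. by elim: n => [|n IH]; [exact: subfield0|rewrite -addn1 natrD;
  apply: subfieldD => //; apply: subfield1]. Qed.

Lemma subfieldXz x (n : int) : S x -> S (x ^ n).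
Proof.
by case: n => n Sx; [|apply: (subfieldV sfS)]; apply: subfieldX.
Qed.

Lemma subfield_int (n : int) : S n%:~R.
Proof. by case: n => n; rewrite ?NegzE ?mulrNz; [|apply: subfieldN];
  apply: subfield_nat. Qed.

Lemma subfield_horner (p : {poly E}) x : (forall i, S p`_i) -> S x -> S p.[x].
Proof.
move=> Sp Sx; rewrite horner_coef; apply: subfield_sum => i _.
by apply: (subfieldM sfS) => //; apply: subfieldX.
Qed.

Definition subfield_pred : {pred E} :=
  fun x => if excluded_middle_informative (S x) then true else false.

Lemma subfield_predP x : reflect (S x) (x \in subfield_pred).
Proof.
by rewrite unfold_in /subfield_pred; case: excluded_middle_informative => ?; constructor.
Qed.

Lemma subfield_pred_closed : divring_closed subfield_pred.
Proof.
split; first exact/subfield_predP/(subfield1 sfS).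
  by move=> x y /subfield_predP Sx /subfield_predP Sy; apply/subfield_predP/(subfieldB sfS).
by move=> x y /subfield_predP Sx /subfield_predP Sy; apply/subfield_predP/subfield_div.
Qed.

HB.instance Definition _ :=
  GRing.isDivringClosed.Build E subfield_pred subfield_pred_closed.

Record subfield_sort := SubfieldSort { subfield_val :> E;
  _ : subfield_val \in subfield_pred }.
HB.instance Definition _ := [isSub for subfield_val].
HB.instance Definition _ := [Choice of subfield_sort by <:].
HB.instance Definition _ := [SubChoice_isSubNzRing of subfield_sort by <:].
HB.instance Definition _ := [SubNzRing_isSubComNzRing of subfield_sort by <:].
HB.instance Definition _ := [SubNzRing_isSubUnitRing of subfield_sort by <:].
HB.instance Definition _ := [SubComUnitRing_isSubIntegralDomain of subfield_sort by <:].
HB.instance Definition _ := [SubIntegralDomain_isSubField of subfield_sort by <:].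

(** Polynomial division, minimal polynomials and matrices are taken over a coefficient field with a
    morphism to [E]; deciding membership in [S] classically turns the predicate into such a
    field. *)
Lemma subfield_image :
  exists (K : fieldType) (iota : {rmorphism K -> E}),
    forall x, S x <-> exists z, x = iota z.
Proof.
exists subfield_sort, (\val : {rmorphism subfield_sort -> E}) => x.
split=> [/subfield_predP Sx|[z ->]]; first by exists (SubfieldSort Sx).
by apply/subfield_predP; case: z.
Qed.

End SubfieldTheory.

(** The intersection of all subfields containing [S] and [xs]. Unlike [adjoin] it starts from a
    predicate, so towers can be formed inside one fixed field [E], and minimality is its induction
    principle. *)
Variant gen (E : fieldType) (S : E -> Prop) (xs : seq E) (y : E) : Prop :=
  Gen of forall T, subfield T -> (forall x, S x -> T x) ->
                   (forall x, x \in xs -> T x) -> T y.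

Section Gen.

Variable E : fieldType.
Implicit Types (S T : E -> Prop) (xs : seq E) (x y : E).

Lemma gen_subfield S xs : subfield (gen S xs).
Proof.
split=> [|x y [Sx] [Sy]|x y [Sx] [Sy]|x [Sx]]; split=> T sfT ST xsT.
- exact: (subfield1 sfT).
- by apply: (subfieldB sfT); [apply: Sx|apply: Sy].
- by apply: (subfieldM sfT); [apply: Sx|apply: Sy].
- by apply: (subfieldV sfT); apply: Sx.
Qed.

Lemma gen_base S xs x : S x -> gen S xs x.
Proof. by move=> Sx; split=> T _ ST _; apply: ST. Qed.

Lemma gen_mem S xs x : x \in xs -> gen S xs x.
Proof. by move=> xsx; split=> T _ _; apply. Qed.

Lemma gen_mem1 S x : gen S [:: x] x.
Proof. by apply: gen_mem; rewrite mem_head. Qed.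

Lemma gen_min S xs T : subfield T -> (forall x, S x -> T x) ->
  (forall x, x \in xs -> T x) -> forall y, gen S xs y -> T y.
Proof. by move=> sfT ST xsT y [Sy]; apply: Sy. Qed.

Lemma gen_cons S x xs y : gen S (x :: xs) y -> gen (gen S [:: x]) xs y.
Proof.
move: y; apply: gen_min.
- exact: gen_subfield.
- by move=> z Sz; do 2!apply: gen_base.
- move=> z; rewrite inE => /orP[/eqP->|xsz]; last exact: gen_mem.
  exact/gen_base/gen_mem1.
Qed.

Section Image.
Variables (S : E -> Prop) (K : fieldType) (iota : {rmorphism K -> E}).
Hypothesis imS : forall x, S x <-> exists z, x = iota z.

Lemma image_subfield : subfield S.
Proof.
split=> [|x y /imS[a ->] /imS[b ->]|x y /imS[a ->] /imS[b ->]|x /imS[a ->]].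
- by apply/imS; exists 1; rewrite rmorph1.
- by apply/imS; exists (a - b); rewrite rmorphB.
- by apply/imS; exists (a * b); rewrite rmorphM.
- by apply/imS; exists a^-1; rewrite fmorphV.
Qed.

Lemma coef_image (p : {poly K}) i : S (map_poly iota p)`_i.
Proof. by rewrite coef_map; apply/imS; exists p`_i. Qed.

Lemma poly_image (p : {poly E}) :
  (forall i, S p`_i) -> exists q : {poly K}, p = map_poly iota q.
Proof.
move=> Sp; have f i : {a | p`_i = iota a}.
  by apply: constructive_indefinite_description; apply/imS.
exists (\poly_(i < size p) sval (f i)); apply/polyP => i.
rewrite coef_map coef_poly; case: ltnP => [_|/leq_sizeP le]; first by case: (f i).
by rewrite le // raddf0.
Qed.

Lemma alg_image x : algebraic_over S x <-> algebraicOver iota x.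
Proof.
split=> [[p [p0 /poly_image[q e] rt]]|[q q0 rt]].
  by exists q; rewrite -?e // -(map_poly_eq0 iota) -e.
exists (map_poly iota q); split=> [|i|//]; first by rewrite map_poly_eq0.
exact: coef_image.
Qed.

Lemma gen1_frac t y : gen S [:: t] y -> exists p q : {poly K},
  (map_poly iota q).[t] != 0 /\ y = (map_poly iota p).[t] / (map_poly iota q).[t].
Proof.
move: y; apply: gen_min => [|x /imS[a ->]|x].
- split.
  + by exists 1, 1; rewrite rmorph1 hornerC oner_neq0 divr1.
  + move=> x y [p [q [q0 ->]]] [p' [q' [q0' ->]]].
    exists (p * q' - p' * q), (q * q').
    rewrite !(rmorphB, rmorphM) /= !hornerE mulf_neq0 //; split=> //.
    by field; rewrite q0 q0'.
  + move=> x y [p [q [q0 ->]]] [p' [q' [q0' ->]]].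
    by exists (p * p'), (q * q'); rewrite !rmorphM !hornerM mulf_neq0 // mulf_div.
  + move=> x [p [q [q0 ->]]].
    have [->|p0] := eqVneq (map_poly iota p).[t] 0.
      by exists 0, 1; rewrite rmorph1 rmorph0 horner0 hornerC oner_neq0 !mul0r invr0.
    by exists q, p; rewrite invf_div.
- by exists a%:P, 1; rewrite rmorph1 map_polyC !hornerE oner_neq0 divr1.
- rewrite inE => /eqP ->; exists 'X, 1.
  by rewrite rmorph1 map_polyX !hornerE oner_neq0 divr1.
Qed.

(** A common denominator in t presents p as a specialised polynomial in two variables, which the
    exchange argument then reads in the other variable. *)
Lemma clear_denominators t (p : {poly E}) : (forall i, gen S [:: t] p`_i) ->
  exists (d : {poly K}) (P : {poly {poly K}}), (map_poly iota d).[t] != 0 /\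
    map_poly (horner_eval t \o map_poly iota) P = (map_poly iota d).[t] *: p.
Proof.
elim/poly_ind: p => [|p c IH] Sp.
  by exists 1, 0; rewrite !rmorph0 scaler0 rmorph1 hornerC oner_neq0.
have [i|d [P [d0 eP]]] := IH; first by have := Sp i.+1; rewrite coefD coefMX coefC addr0.
have := Sp 0%N; rewrite coefD coefMX coefC add0r => /gen1_frac[a [b [b0 ec]]].
exists (d * b), ((b *: P) * 'X + (a * d)%:P).
rewrite rmorphM hornerM mulf_neq0 //; split=> //.
rewrite rmorphD rmorphM /= map_polyX map_polyC map_polyZ /= eP /horner_eval ec rmorphM
  hornerM.
rewrite scalerDr scalerA -scalerAl [in LHS]mulrC; congr (_ + _).
by rewrite -mul_polyC -polyCM; congr _%:P; field.
Qed.

(** A relation between t and x is a polynomial in two variables. Read as a polynomial in t with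
    coefficients in K[x], it stays nonzero at x because x is transcendental. *)
Lemma exchange_image t x : algebraic_over (gen S [:: t]) x -> ~ algebraic_over S x ->
  algebraic_over (gen S [:: x]) t.
Proof.
move=> [p [p0 Sp /rootP px]] xtr; have [d [P [d0 eP]]] := clear_denominators Sp.
pose ev z (q : {poly K}) := (map_poly iota q).[z].
have ev0 q : ev x q = 0 -> q = 0.
  move=> e; apply: NNPP => q0; apply: xtr; apply/alg_image; exists q; last exact/rootP.
  exact/eqP.
have P0 : P != 0.
  by apply: contraNneq p0 => P0; move: eP; rewrite P0 rmorph0 => /esym/eqP;
    rewrite scaler_eq0 (negPf d0).
exists (map_poly (horner_eval x \o map_poly iota) (swapXY P)); split.
- have : swapXY P != 0 by rewrite swapXY_eq0.
  apply: contraNneq => e; apply/eqP/polyP => i; rewrite coef0; apply: ev0.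
  by have /polyP/(_ i) := e; rewrite coef_map coef0.
- move=> i; rewrite coef_map /= /horner_eval; apply: subfield_horner.
  + exact: gen_subfield.
  + by move=> j; apply: gen_base; apply: coef_image.
  + exact: gen_mem1.
- have Q z w (R : {poly {poly K}}) :
    (map_poly (horner_eval z \o map_poly iota) R).[w] =
    (map_poly (map_poly iota) R).[w%:P].[z].
    elim/poly_ind: R => [|R c IH]; first by rewrite !rmorph0 !horner0.
    by rewrite !rmorphD !rmorphM /= !map_polyX !map_polyC !hornerE IH.
  rewrite /root Q.
  have -> : map_poly (map_poly iota) (swapXY P) = swapXY (map_poly (map_poly iota) P).
    by rewrite swapXY_map.
  by rewrite horner2_swapXY -Q eP hornerZ px mulr0.
Qed.

End Image.

Lemma alg_base S x : subfield S -> S x -> algebraic_over S x.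
Proof.
move=> sfS Sx; exists ('X - x%:P); split; rewrite ?polyXsubC_eq0 ?root_XsubC //.
move=> i; rewrite coefB coefX coefC; apply: subfieldB => //.
  by case: eqP => _; [apply: subfield1|apply: subfield0].
by case: eqP => _ //; apply: subfield0.
Qed.

Lemma alg_mono S T : (forall x, S x -> T x) ->
  forall x, algebraic_over S x -> algebraic_over T x.
Proof. by move=> ST x [p [p0 Sp px]]; exists p; split=> // i; apply: ST. Qed.

Lemma alg_subfield S : subfield S -> subfield (algebraic_over S).
Proof.
move=> sfS; have [K [iota imS]] := subfield_image sfS.
split=> [|x y|x y|x]; rewrite !(alg_image imS); [|move=> Sx Sy|move=> Sx Sy|move=> Sx].
- exact: algebraic1.
- exact: algebraic_sub.
- exact: algebraic_mul.
- exact: algebraic_inv.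
Qed.

Lemma alg_trans S x : subfield S -> algebraic_over (algebraic_over S) x ->
  algebraic_over S x.
Proof.
move=> sfS [p [p0 Sp px]]; have [K [iota imS]] := subfield_image sfS.
apply/(alg_image imS)/integral_algebraic/(integral_root p0 px)/integral_poly => i.
by apply/integral_algebraic/(alg_image imS).
Qed.

Lemma alg_gen S xs y : subfield S -> (forall x, x \in xs -> algebraic_over S x) ->
  gen S xs y -> algebraic_over S y.
Proof.
move=> sfS Sxs; apply: gen_min Sxs y; first exact: alg_subfield.
by move=> x; apply: alg_base.
Qed.

Lemma alg_trans_gen S xs y : subfield S -> (forall x, x \in xs -> algebraic_over S x) ->
  algebraic_over (gen S xs) y -> algebraic_over S y.
Proof.
move=> sfS Sxs Sy; apply: alg_trans => //.
by apply: alg_mono Sy => x; apply: alg_gen.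
Qed.

Lemma exchange S t x : subfield S -> algebraic_over (gen S [:: t]) x ->
  ~ algebraic_over S x -> algebraic_over (gen S [:: x]) t.
Proof.
by move=> /subfield_image[K [iota imS]]; exact: (exchange_image imS).
Qed.

End Gen.

(** * Derivations *)

(** An extended derivation is a total function on [E] with arbitrary values outside the subfield
    generated so far, so the rules are asked on [T] alone. Stability of [T] under [d] is a separate
    matter. *)
Definition der_on (E : fieldType) (T : E -> Prop) (d : E -> E) : Prop :=
  (forall x y, T x -> T y -> d (x + y) = d x + d y) /\
  (forall x y, T x -> T y -> d (x * y) = d x * y + x * d y).

Lemma derivation_der_on (E : fieldType) (T : E -> Prop) (d : E -> E) :
  derivation d -> der_on T d.
Proof. by move=> [dD dM]; split=> *; [apply: dD|apply: dM]. Qed.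

Lemma der_on_sub (E : fieldType) (S T : E -> Prop) (d : E -> E) :
  (forall x, S x -> T x) -> der_on T d -> der_on S d.
Proof. by move=> ST [dD dM]; split=> *; [apply: dD|apply: dM]; apply: ST. Qed.

Definition dlog (E : fieldType) (d : E -> E) (w : E) : E := d w / w.

Section DerOn.

Variables (E : fieldType) (T : E -> Prop) (d : E -> E).
Hypotheses (sfT : subfield T) (dT : der_on T d).

Lemma der0 : d 0 = 0.
Proof.
have T0 := subfield0 sfT.
by apply: (addrI (d 0)); rewrite -(dT.1 _ _ T0 T0) !addr0.
Qed.

Lemma der1 : d 1 = 0.
Proof.
have T1 := subfield1 sfT.
by apply: (addrI (d 1)); rewrite addr0 -{3}[1]mulr1 dT.2 // mul1r mulr1.
Qed.

Lemma derN x : T x -> d (- x) = - d x.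
Proof.
move=> Tx; have TNx := subfieldN sfT Tx.
by apply: (addrI (d x)); rewrite -dT.1 // !subrr der0.
Qed.

Lemma derB x y : T x -> T y -> d (x - y) = d x - d y.
Proof. by move=> Tx Ty; rewrite dT.1 ?derN //; apply: subfieldN. Qed.

Lemma der_sum (I : Type) (r : seq I) (P : pred I) (G : I -> E) :
  (forall i, P i -> T (G i)) ->
  d (\sum_(i <- r | P i) G i) = \sum_(i <- r | P i) d (G i).
Proof.
move=> TG; suff [] : T (\sum_(i <- r | P i) G i) /\
  d (\sum_(i <- r | P i) G i) = \sum_(i <- r | P i) d (G i) by [].
apply: (big_rec2 (fun x y => T x /\ d x = y)) => [|i x y Pi [Ty <-]].
  by split; [exact: subfield0|exact: der0].
by split; [apply: subfieldD|rewrite dT.1]; auto.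
Qed.

Lemma der_nat n : d n%:R = 0.
Proof.
elim: n => [|n IH]; first exact: der0.
by rewrite -addn1 natrD dT.1 ?IH ?der1 ?addr0 //;
  [apply: (subfield_nat sfT)|apply: (subfield1 sfT)].
Qed.

Lemma der_mulc c x : T c -> T x -> d c = 0 -> d (c * x) = c * d x.
Proof. by move=> Tc Tx dc; rewrite dT.2 // dc mul0r add0r. Qed.

Lemma der_div x y : T x -> T y -> y != 0 -> d (x / y) = (d x * y - x * d y) / y ^+ 2.
Proof.
move=> Tx Ty y0; have Txy := subfield_div sfT Tx Ty.
have : d (x / y * y) = d x by rewrite divfK.
by rewrite dT.2 // => <-; field.
Qed.

Lemma dlogM x y : T x -> T y -> x != 0 -> y != 0 ->
  dlog d (x * y) = dlog d x + dlog d y.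
Proof. by move=> Tx Ty x0 y0; rewrite /dlog dT.2 //; field; rewrite x0 y0. Qed.

Lemma dlogV x : T x -> x != 0 -> dlog d x^-1 = - dlog d x.
Proof.
move=> Tx x0; rewrite /dlog -[x^-1]mul1r der_div //; last exact: subfield1.
by rewrite der1 !mul1r invrK mul0r sub0r; field.
Qed.

Lemma dlog1 : dlog d 1 = 0.
Proof. by rewrite /dlog der1 mul0r. Qed.

Lemma dlogX x n : T x -> x != 0 -> dlog d (x ^+ n) = n%:R * dlog d x.
Proof.
move=> Tx x0; elim: n => [|n IH]; first by rewrite expr0 dlog1 mul0r.
rewrite exprS dlogM ?expf_neq0 ?IH //; last exact: subfieldX.
by rewrite -addn1 natrD; ring.
Qed.

Lemma dlogXz x (n : int) : T x -> x != 0 -> dlog d (x ^ n) = n%:~R * dlog d x.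
Proof.
move=> Tx x0; case: n => n; first exact: dlogX.
rewrite -[x ^ _]/((x ^+ n.+1)^-1) dlogV ?expf_neq0 //; last exact: subfieldX.
by rewrite dlogX // NegzE mulrNz mulNr.
Qed.

Lemma map_poly_derD (p q : {poly E}) : (forall i, T p`_i) -> (forall i, T q`_i) ->
  map_poly d (p + q) = map_poly d p + map_poly d q.
Proof.
by move=> Tp Tq; apply/polyP => i; rewrite coefD !coef_map_id0 ?der0 // coefD dT.1.
Qed.

Lemma map_poly_derM (p q : {poly E}) : (forall i, T p`_i) -> (forall i, T q`_i) ->
  map_poly d (p * q) = map_poly d p * q + p * map_poly d q.
Proof.
move=> Tp Tq; apply/polyP => i; rewrite coefD coef_map_id0 ?der0 // !coefM.
rewrite der_sum => [|j _]; last exact: (subfieldM sfT).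
rewrite -big_split; apply: eq_bigr => j _.
by rewrite !coef_map_id0 ?der0 // dT.2.
Qed.

Lemma der_horner (p : {poly E}) x : (forall i, T p`_i) -> T x ->
  d p.[x] = (map_poly d p).[x] + p^`().[x] * d x.
Proof.
move=> Tp Tx; elim/poly_ind: p Tp => [|p c IH] Tp.
  by rewrite map_poly0 deriv0 horner0 der0 mul0r addr0.
have Tq i : T p`_i by have := Tp i.+1; rewrite coefD coefMX coefC addr0.
have Tc : T c by have := Tp 0%N; rewrite coefD coefMX coefC add0r.
have -> : map_poly d (p * 'X + c%:P) = map_poly d p * 'X + (d c)%:P.
  apply/polyP => i;
    rewrite coef_map_id0 ?der0 // !coefD !coefMX !coefC coef_map_id0 ?der0 //.
  by case: i => [|i] /=; rewrite ?add0r ?addr0.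
have Tpx : T p.[x] by apply: subfield_horner.
rewrite derivD derivM derivX derivC !hornerE dT.1 //; last exact: subfieldM.
by rewrite dT.2 // IH //; ring.
Qed.

End DerOn.

Lemma der_comp_comm (E : fieldType) (T : E -> Prop) (d e : E -> E) :
  subfield T -> der_on T d -> der_on T e ->
  (forall x, T x -> T (d x)) -> (forall x, T x -> T (e x)) ->
  der_on T (fun x => d (e x) - e (d x)).
Proof.
move=> sfT [dD dM] [eD eM] dT eT; split=> x y Tx Ty.
  by rewrite dD // eD // dD ?eD; auto; ring.
have [Tdx Tdy Tex Tey] := And4 (dT _ Tx) (dT _ Ty) (eT _ Tx) (eT _ Ty).
rewrite dM // eM // dD; [|exact: subfieldM..].
rewrite eD; [|exact: subfieldM..].
by rewrite !dM // !eM //; ring.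
Qed.

(** * Minimal polynomials and extension of derivations *)

Section MinPoly.

Variables (K E : fieldType) (iota : {rmorphism K -> E}).

Lemma minimal_poly x : algebraicOver iota x ->
  exists p : {poly K}, [/\ p \is monic, (map_poly iota p).[x] = 0
    & forall q, q != 0 -> (map_poly iota q).[x] = 0 -> (size p <= size q)%N].
Proof.
case=> p p0 /rootP; elim: {p}_.+1 {-2}p (ltnSn (size p)) p0 => // n IH p lepn p0 px.
have [[q [q0 qx lqp]]|H] := classic (exists q : {poly K},
    [/\ q != 0, (map_poly iota q).[x] = 0 & (size q < size p)%N]).
  by apply: IH q0 qx; apply: leq_trans lqp _.
exists ((lead_coef p)^-1 *: p); split.
- by rewrite monicE lead_coefZ mulVf ?lead_coef_eq0.
- by rewrite map_polyZ hornerZ px mulr0.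
move=> q q0 qx; rewrite size_scale ?invr_eq0 ?lead_coef_eq0 // leqNgt.
by apply/negP => lt; apply: H; exists q.
Qed.

Lemma minimal_poly_dvd x (p q : {poly K}) : p \is monic ->
  (map_poly iota p).[x] = 0 ->
  (forall r, r != 0 -> (map_poly iota r).[x] = 0 -> (size p <= size r)%N) ->
  (map_poly iota q).[x] = 0 -> p %| q.
Proof.
move=> pm px pmin qx; apply: contraT; rewrite /dvdp => r0.
have /pmin : (map_poly iota (q %% p)).[x] = 0.
  have := congr1 (fun r => (map_poly iota r).[x]) (divp_eq q p).
  by rewrite /= rmorphD rmorphM hornerD hornerM px qx mulr0 add0r.
by move=> /(_ r0); rewrite leqNgt ltn_modp monic_neq0.
Qed.

Lemma size_deriv_char0 (p : {poly K}) : [pchar K] =i pred0 ->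
  (1 < size p)%N -> p^`() != 0.
Proof.
move=> ch0 sp; apply/eqP => /polyP/(_ (size p).-2); rewrite coef_deriv coef0.
have -> : (size p).-2.+1 = (size p).-1 by case: (size p) sp => [|[]].
rewrite -mulr_natr -/(lead_coef p) => /eqP; rewrite mulf_eq0 lead_coef_eq0.
have /pcharf0P -> := ch0; rewrite -size_poly_eq0.
by case: (size p) sp => [|[]].
Qed.

Lemma minimal_poly_deriv x (p : {poly K}) : [pchar K] =i pred0 -> p \is monic ->
  (map_poly iota p).[x] = 0 ->
  (forall r, r != 0 -> (map_poly iota r).[x] = 0 -> (size p <= size r)%N) ->
  (map_poly iota p)^`().[x] != 0.
Proof.
move=> ch0 pm px pmin; apply/eqP; rewrite deriv_map => /pmin H.
have sp : (1 < size p)%N.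
  have [//|] := ltnP 1 (size p); rewrite leq_eqVlt ltnS leqn0 size_poly_eq0.
  rewrite (negPf (monic_neq0 pm)) orbF => /size_poly1P[c c0 e].
  by move/eqP: px; rewrite e map_polyC hornerC fmorph_eq0 (negPf c0).
have := H (size_deriv_char0 ch0 sp); rewrite leqNgt lt_size_deriv //.
by rewrite monic_neq0.
Qed.

End MinPoly.

Lemma pchar0_morph (K E : fieldType) (iota : {rmorphism K -> E}) :
  [pchar E] =i pred0 -> [pchar K] =i pred0.
Proof. by move=> chE p; rewrite -(fmorph_pchar iota). Qed.

Lemma pchar0_natr (E : fieldType) n : [pchar E] =i pred0 -> (0 < n)%N -> n%:R != 0 :> E.
Proof. by move=> /pcharf0P ->; case: n. Qed.

Section DerExtension.

Variable E : fieldType.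
Implicit Types (S T : E -> Prop) (xs : seq E) (d : E -> E).

(** In characteristic zero x is a simple root of its minimal polynomial. The cofactor [h] has its
    coefficients in [S] again, so that a derivation known only on [S] can be applied to [h * p]. *)
Lemma alg_separable S x : [pchar E] =i pred0 -> subfield S -> algebraic_over S x ->
  exists p : {poly E}, [/\ forall i, S p`_i, p.[x] = 0, p^`().[x] != 0 &
   forall g : {poly E}, (forall i, S g`_i) -> g.[x] = 0 ->
     exists2 h : {poly E}, g = h * p & forall i, S h`_i].
Proof.
move=> ch0 sfS; have [K [iota imS]] := subfield_image sfS.
move=> /(alg_image imS)/minimal_poly[p [pm px pmin]].
exists (map_poly iota p); split=> //; first exact: coef_image.
  by apply: minimal_poly_deriv => //; apply: pchar0_morph ch0.
move=> g /(poly_image imS)[q ->] qx.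
have /dvdpP[h ->] := minimal_poly_dvd pm px pmin qx.
by exists (map_poly iota h); [rewrite rmorphM|exact: coef_image].
Qed.

(** Differentiating p(x) = 0 gives d x = - p^d(x) / p'(x), where p^d has the differentiated
    coefficients. *)
Lemma der_alg_mem S T V d x : [pchar E] =i pred0 -> subfield S -> subfield T ->
  subfield V -> der_on T d -> (forall y, S y -> T y /\ V y) ->
  (forall y, S y -> V (d y)) -> T x -> V x -> algebraic_over S x -> V (d x).
Proof.
move=> ch0 sfS sfT sfV dT ST dS Tx Vx /(alg_separable ch0 sfS)[p [Sp px p'x _]].
have := der_horner sfT dT (fun i => (ST _ (Sp i)).1) Tx.
rewrite px (der0 sfT dT) => /esym/eqP; rewrite addrC addr_eq0 => /eqP e.
rewrite -[d x](mulKf p'x) e; apply: (subfieldM sfV).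
  apply/(subfieldV sfV)/(subfield_horner sfV) => // i.
  by rewrite coef_deriv -mulr_natr; apply: (subfieldM sfV);
    [exact: (ST _ (Sp _)).2|exact: subfield_nat].
apply/(subfieldN sfV)/(subfield_horner sfV) => // i.
by rewrite coef_map_id0 ?(der0 sfT dT) //; apply: dS.
Qed.

(** Here p^d = 0, which leaves p'(x) d x = 0. Applied to a commutator of derivations, this
    propagates commutation to algebraic elements. *)
Lemma der_alg_eq0 S T d x : [pchar E] =i pred0 -> subfield S -> subfield T ->
  der_on T d -> (forall y, S y -> T y) ->
  (forall y, S y -> d y = 0) -> T x -> algebraic_over S x -> d x = 0.
Proof.
move=> ch0 sfS sfT dT ST dS Tx /(alg_separable ch0 sfS)[p [Sp px p'x _]].
have := der_horner sfT dT (fun i => ST _ (Sp i)) Tx.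
rewrite px (der0 sfT dT) (_ : map_poly d p = 0) ?horner0 ?add0r => [/esym/eqP|].
  by rewrite mulf_eq0 (negPf p'x) => /eqP.
by apply/polyP => i; rewrite coef_map_id0 ?(der0 sfT dT) // coef0 dS.
Qed.

Lemma der_gen_closed S T V xs d : subfield T -> subfield V -> der_on T d ->
  (forall y, gen S xs y -> T y) ->
  (forall y, S y -> V y) -> (forall x, x \in xs -> V x) ->
  (forall y, S y -> V (d y)) -> (forall x, x \in xs -> V (d x)) ->
  forall y, gen S xs y -> V (d y).
Proof.
move=> sfT sfV dT ST SV xsV dS dxs y Gy.
(* Membership in [T] and [V] is carried along because the product and quotient rules call for it. *)
suff [] : (T y /\ V y) /\ V (d y) by [].
move: y Gy; apply: gen_min => [|x Sx|x xsx].
- split=> [|x y [[Tx Vx] Vdx] [[Ty Vy] Vdy]|x y [[Tx Vx] Vdx] [[Ty Vy] Vdy]|x [[Tx Vx]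
  Vdx]].
  + rewrite (der1 sfT dT); split; last exact: subfield0.
    by split; apply: subfield1.
  + by rewrite (derB sfT dT) //; do !split; apply: subfieldB.
  + rewrite dT.2 //; do !split; try exact: subfieldM.
    by apply: (subfieldD sfV); apply: subfieldM.
  + have [->|x0] := eqVneq x 0.
      by rewrite invr0 (der0 sfT dT); do !split; apply: subfield0.
    do !split; try exact: subfieldV.
    rewrite -[x^-1]mul1r (der_div sfT dT) //; last exact: subfield1.
    rewrite (der1 sfT dT) mul0r mul1r add0r.
    by apply: (subfield_div sfV); [apply: subfieldN|apply: subfieldX].
- by do !split; auto; apply: ST; apply: gen_base.
- by do !split; auto; apply: ST; apply: gen_mem.
Qed.

(** The condition on [g] says that the value z for d x respects every algebraic relation of x over
    [S]; the quotient rule on p(x) / q(x) then does not depend on the chosen fraction. *)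
Lemma der_extend S d x z : subfield S -> der_on S d ->
  (forall g : {poly E}, (forall i, S g`_i) -> g.[x] = 0 ->
     (map_poly d g).[x] + g^`().[x] * z = 0) ->
  exists2 d' : E -> E, der_on (gen S [:: x]) d' &
    (forall y, S y -> d' y = d y) /\ d' x = z.
Proof.
move=> sfS dS zP; have [K [iota imS]] := subfield_image sfS.
(* [A q] is q(x), and [B q] is the value the extension has to give it. *)
pose A (q : {poly K}) := (map_poly iota q).[x].
pose B (q : {poly K}) :=
  (map_poly d (map_poly iota q)).[x] + (map_poly iota q)^`().[x] * z.
have cS q i : S (map_poly iota q)`_i := coef_image imS q i.
have AD p q : A (p + q) = A p + A q by rewrite /A rmorphD hornerD.
have AM p q : A (p * q) = A p * A q by rewrite /A rmorphM hornerM.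
have BD p q : B (p + q) = B p + B q.
  rewrite /B (_ : map_poly iota (p + q) = map_poly iota p + map_poly iota q) ?rmorphD //.
  by rewrite (map_poly_derD sfS dS) // derivD !hornerD; ring.
have BM p q : B (p * q) = B p * A q + A p * B q.
  rewrite /B /A rmorphM /= (map_poly_derM sfS dS) // derivM !(hornerD, hornerM).
  by ring.
have A0 q : A q = 0 -> B q = 0 by apply: zP.
have AB p q : A p = A q -> B p = B q.
  move=> e; have /A0 : A (p - q) = 0.
    by rewrite AD -[A (- q)]/((map_poly iota (- q)).[x]) rmorphN hornerN e -/(A q) subrr.
  by move=> e0; rewrite -[p](subrK q) [LHS]BD e0 add0r.
pose G p q := (B p * A q - A p * B q) / A q ^+ 2.
have Gwd p q p' q' : A q != 0 -> A q' != 0 -> A p / A q = A p' / A q' -> G p q = G p' q'.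
  move=> q0 q0' /eqP; rewrite eqr_div // -!AM => /eqP e.
  apply/eqP; rewrite eqr_div ?expf_neq0 //; apply/eqP; apply: aux_wd.
    by rewrite -!AM e.
  by rewrite -!BM (AB _ _ e).
have dC a : map_poly d a%:P = (d a)%:P.
  by apply/polyP => i; rewrite coef_map_id0 ?(der0 sfS dS) // !coefC; case: eqP => // _;
    exact: (der0 sfS dS).
have A1 : A 1 = 1 by rewrite /A rmorph1 hornerC.
have B1 : B 1 = 0.
  by rewrite /B rmorph1 -polyC1 derivC horner0 mul0r addr0 dC hornerC (der1 sfS dS).
have ex y : {pq : {poly K} * {poly K} | gen S [:: x] y -> A pq.2 != 0 /\ y = A pq.1 / A
  pq.2}.
  apply: constructive_indefinite_description.
  have [/(gen1_frac imS)[p [q [q0 ->]]]|] := classic (gen S [:: x] y);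
    first by exists (p, q).
  by exists (0, 0).
pose d' y := G (sval (ex y)).1 (sval (ex y)).2.
have AG p q : A q != 0 -> gen S [:: x] (A p / A q).
  move=> q0; apply: subfield_div; first exact: gen_subfield.
    by apply: (subfield_horner (gen_subfield _ _)) => [i|];
      [exact: gen_base|exact: gen_mem1].
  by apply: (subfield_horner (gen_subfield _ _)) => [i|]; [exact: gen_base|exact: gen_mem1].
have d'E p q : A q != 0 -> d' (A p / A q) = G p q.
  move=> q0; have := AG p _ q0; rewrite /d'; case: (ex _) => -[a b] /= H /H[b0 e].
  exact/esym/Gwd.
exists d'; [split=> y w|split=> [y Sy|]].
- move=> /(gen1_frac imS)[p [q [q0 ->]]] /(gen1_frac imS)[p' [q' [q0' ->]]].
  rewrite -!/(A _) addf_div // -!AM -AD !d'E ?AM ?mulf_neq0 // /G !(BD, BM, AD, AM).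
  exact: aux_add.
- move=> /(gen1_frac imS)[p [q [q0 ->]]] /(gen1_frac imS)[p' [q' [q0' ->]]].
  rewrite -!/(A _) mulf_div -!AM !d'E ?AM ?mulf_neq0 // /G !(BD, BM, AD, AM).
  exact: aux_mul.
- have /imS[a e] := Sy.
  have ey : y = A a%:P / A 1 by rewrite A1 divr1 /A map_polyC hornerC.
  rewrite {1}ey.
  rewrite d'E ?A1 ?oner_neq0 // /G A1 B1 mulr0 subr0 mulr1 expr1n !divr1.
  by rewrite /B map_polyC derivC horner0 mul0r addr0 dC hornerC e.
- have -> : x = A 'X / A 1 by rewrite A1 divr1 /A map_polyX hornerX.
  rewrite d'E ?A1 ?oner_neq0 // /G A1 B1 mulr0 subr0 mulr1 expr1n divr1.
  rewrite /B map_polyX derivX hornerC mul1r (_ : map_poly d 'X = 0) ?horner0 ?add0r //.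
  apply/polyP => i; rewrite coef_map_id0 ?(der0 sfS dS) // coefX coef0.
  by case: eqP => _; [exact: (der1 sfS dS)|exact: (der0 sfS dS)].
Qed.

Lemma der_extend_transc S d x z : subfield S -> der_on S d ->
  ~ algebraic_over S x ->
  exists2 d' : E -> E, der_on (gen S [:: x]) d' &
    (forall y, S y -> d' y = d y) /\ d' x = z.
Proof.
move=> sfS dS xtr; apply: der_extend => // g Sg gx.
suff -> : g = 0 by rewrite map_poly0 deriv0 !horner0 mul0r addr0.
apply: NNPP => g0; apply: xtr; exists g; split=> //; first exact/eqP.
exact/rootP.
Qed.

Lemma der_extend_alg S d xs : [pchar E] =i pred0 -> subfield S -> der_on S d ->
  (forall x, x \in xs -> algebraic_over S x) ->
  exists2 d' : E -> E, der_on (gen S xs) d' & (forall y, S y -> d' y = d y).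
Proof.
move=> ch0; elim: xs S d => [|x xs IH] S d sfS dS Sxs.
  exists d => //; apply: der_on_sub dS => x; apply: gen_min => //.
have /(alg_separable ch0 sfS)[p [Sp px p'x pmin]] := Sxs x (mem_head _ _).
(* The only possible value of d x, forced by differentiating p(x) = 0. *)
have [] := @der_extend S d x (- (map_poly d p).[x] / p^`().[x]) sfS dS.
  move=> g Sg /(pmin _ Sg)[h -> Sh].
  rewrite (map_poly_derM sfS dS) // derivM !(hornerD, hornerM) px.
  by field.
move=> d1 d1S [d1E _].
have [||y xsy|d2 d2S d2E] := IH (gen S [:: x]) d1; first exact: gen_subfield.
- exact: d1S.
- apply: (@alg_mono _ S) => [w|]; [exact: gen_base|apply: Sxs; rewrite inE xsy orbT //].
exists d2 => [|y Sy]; last by rewrite d2E ?d1E //; apply: gen_base.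
by apply: der_on_sub d2S => y; apply: gen_cons.
Qed.

End DerExtension.

(** * Traces and norms *)

Section Jacobi.

Variables (R : comNzRingType) (D : R -> R).
Hypothesis dD : derivation D.

Lemma derivation0 : D 0 = 0.
Proof. by apply: (addrI (D 0)); rewrite -dD.1 !addr0. Qed.

Lemma derivation1 : D 1 = 0.
Proof. by apply: (addrI (D 1)); rewrite addr0 -{3}[1]mulr1 dD.2 mul1r mulr1. Qed.

Lemma derivationN x : D (- x) = - D x.
Proof. by apply: (addrI (D x)); rewrite -dD.1 !subrr derivation0. Qed.

Lemma derivation_prod (I : finType) (G : I -> R) :
  D (\prod_i G i) = \sum_i D (G i) * \prod_(j | j != i) G j.
Proof.
suff H (r : seq I) : uniq r -> D (\prod_(i <- r) G i) =
    \sum_(i <- r) D (G i) * \prod_(j <- r | j != i) G j.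
  by rewrite H // index_enum_uniq.
elim: r => [|a r IH] /=; first by rewrite !big_nil derivation1.
move=> /andP[ar ur]; rewrite !big_cons dD.2 IH // eqxx /=; congr (_ * _ + _).
  rewrite big_seq [RHS]big_seq_cond; apply: eq_bigl => j; case jr : (j \in r) => //=.
  by apply/esym; apply: contraNneq ar => <-.
rewrite mulr_sumr big_seq [RHS]big_seq; apply: eq_bigr => i ir.
have ai : a != i by apply: contraNneq ar => ->.
by rewrite big_cons ai mulrCA.
Qed.

(** Differentiating the permutation expansion row by row gives the determinants of the [B i], in
    which row i of [A] is differentiated; expanding along that row brings out the cofactors, which
    are the entries of the adjugate. *)
Lemma jacobi_formula n (A : 'M[R]_n) : D (\det A) = \tr (\adj A *m map_mx D A).
Proof.
pose B i : 'M[R]_n := \matrix_(k, j) if k == i then D (A i j) else A k j.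
have -> : \tr (\adj A *m map_mx D A) = \sum_i \det (B i).
  under [RHS]eq_bigr => i _ do rewrite (expand_det_row _ i).
  rewrite /mxtrace exchange_big /=; apply: eq_bigr => j _; rewrite mxE.
  apply: eq_bigr => i _; rewrite !mxE eqxx mulrC; congr (_ * _).
  rewrite /cofactor; congr (_ * \det _); apply/matrixP => k l; rewrite !mxE.
  by rewrite eq_sym (negPf (neq_lift _ _)).
rewrite /determinant derivation_sum // exchange_big /=; apply: eq_bigr => s _.
have -> : D ((-1) ^+ s * \prod_i A i (s i)) = (-1) ^+ s * D (\prod_i A i (s i)).
  by case: (odd_perm s); rewrite ?expr1 ?expr0 ?mul1r // !mulN1r derivationN.
rewrite derivation_prod mulr_sumr; apply: eq_bigr => i _; congr (_ * _).
rewrite [RHS](bigD1 i) //= !mxE eqxx; congr (_ * _).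
by apply: eq_bigr => j ji; rewrite mxE (negPf ji).
Qed.

End Jacobi.

Section Trace.

Variables (E : fieldType) (S : E -> Prop) (x : E) (d : E -> E).
Hypotheses (ch0 : [pchar E] =i pred0) (sfS : subfield S).
Hypotheses (algx : algebraic_over S x).
Hypotheses (dT : der_on (gen S [:: x]) d) (dS : forall y, S y -> S (d y)).

(** Multiplication by y on the basis 1, x, ..., x^n of S(x) is a matrix M. [V] and the [W k] are the
    trace of v and the norms of the [w k], and N is the degree n + 1. The matrix of d y is the
    entrywise derivative of M plus a commutator, of trace 0, and the Jacobi formula identifies the
    trace of dw/w with dlog of the norm. An element of [S] acts as a scalar matrix, whence the last
    two clauses. *)
Lemma trace_simple m (c w : 'I_m -> E) (v r : E) :
  (forall k, S (c k)) -> (forall k, gen S [:: x] (w k)) -> (forall k, w k != 0) ->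
  gen S [:: x] v -> S r -> d v + \sum_k c k * dlog d (w k) = r ->
  exists (N : nat) (V : E) (W : 'I_m -> E),
    [/\ (0 < N)%N, S V /\ (forall k, S (W k) /\ W k != 0),
        d V + \sum_k c k * dlog d (W k) = N%:R * r,
        S v -> V = N%:R * v & forall k, S (w k) -> W k = w k ^+ N].
Proof.
pose T := gen S [:: x]; have sfT : subfield T by apply: gen_subfield.
have dU : der_on T d by [].
have [K [iota imS]] := subfield_image sfS.
have [p [pm px pmin]] := minimal_poly ((alg_image imS x).1 algx).
have p'x := minimal_poly_deriv (pchar0_morph iota ch0) pm px pmin.
have [n sp] : exists n, size p = n.+2.
  case e: (size p) => [|[|n]]; last by exists n.
    by move/eqP: e; rewrite size_poly_eq0 (negPf (monic_neq0 pm)).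
  move/eqP: e => /size_poly1P[a a0 e]; move: p'x.
  by rewrite e map_polyC derivC horner0 eqxx.
have ST y : S y -> T y by apply: gen_base.
have dTT y : T y -> T (d y).
  apply: (@der_gen_closed _ S T T [:: x]) => //.
  - by move=> z; rewrite inE => /eqP ->; apply: gen_mem1.
  - by move=> z /dS/ST.
  move=> z; rewrite inE => /eqP ->.
  apply: (@der_alg_mem _ S T T d) => //; [by split; apply: ST|by move=> y0 /dS/ST| |];
    exact: gen_mem1.
have exD a : {b | d (iota a) = iota b}.
  by apply: constructive_indefinite_description; apply/imS/dS/imS; exists a.
pose D a := sval (exD a); have DE a : d (iota a) = iota (D a) by rewrite /D; case: (exD a).
have Ti a : T (iota a) by apply/ST/imS; exists a.
have dD : derivation D.
  split=> a b; apply: (fmorph_inj iota); rewrite -DE !(rmorphD, rmorphM) -?DE.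
    by rewrite dU.1.
  by rewrite dU.2.
pose b : 'cV[E]_n.+1 := \col_i x ^+ i.
pose hasM y (M : 'M[K]_n.+1) := y *: b = map_mx iota M *m b.
have free (u : 'rV[K]_n.+1) : map_mx iota u *m b = 0 -> u = 0.
  move=> /matrixP/(_ 0 0); rewrite !mxE => e; rewrite -[u]rVpolyK.
  suff -> : rVpoly u = 0 by rewrite linear0.
  apply/eqP/contraT => /pmin; rewrite sp ltnNge size_poly; apply.
  rewrite (@horner_coef_wide _ n.+1); last first.
    by rewrite size_map_poly size_poly.
  by rewrite -[RHS]e; apply: eq_bigr => i _; rewrite coef_map coef_rVpoly_ord !mxE.
have uniqM y M M' : hasM y M -> hasM y M' -> M = M'.
  move=> e e'; apply/row_matrixP => i; apply/eqP; rewrite -subr_eq0 -raddfB /=;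
    apply/eqP/free.
  by rewrite map_row -row_mul raddfB mulmxBl -e -e' subrr row0.
have MM y y' M M' : hasM y M -> hasM y' M' -> hasM (y * y') (M *m M').
  by move=> e e'; rewrite /hasM map_mxM -mulmxA -e' -scalemxAr -e scalerA mulrC.
have Mi a : hasM (iota a) a%:M.
  by rewrite /hasM map_scalar_mx mul_scalar_mx.
have MB y y' M M' : hasM y M -> hasM y' M' -> hasM (y - y') (M - M').
  by move=> e e'; rewrite /hasM raddfB mulmxBl -e -e' scalerBl.
have MD y y' M M' : hasM y M -> hasM y' M' -> hasM (y + y') (M + M').
  by move=> e e'; rewrite /hasM raddfD mulmxDl -e -e' scalerDl.
have Munit y M : y != 0 -> hasM y M -> M \in unitmx.
  move=> y0 e; rewrite unitmxE unitfE; apply/negP => /det0P[u u0 uM].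
  have /free/eqP : map_mx iota u *m b = 0; last by rewrite (negPf u0).
  apply: (scalerI y0); rewrite scaler0 scalemxAr e mulmxA -map_mxM uM.
  by rewrite map_mx0 mul0mx.
have exM y : T y -> exists M, hasM y M.
  move: y; apply: gen_min => [|y /imS[a ->]|y].
  - split=> [|y y' [M e] [M' e']|y y' [M e] [M' e']|y [M e]].
    + by exists 1%:M; have := Mi 1; rewrite rmorph1.
    + by exists (M - M'); apply: MB.
    + by exists (M *m M'); apply: MM.
    + have [->|y0] := eqVneq y 0; first by exists 0;
      rewrite invr0 /hasM scale0r map_mx0 mul0mx.
      exists (invmx M); rewrite /hasM; apply: (scalerI y0).
      rewrite scalerA divff // scale1r scalemxAr e mulmxA -map_mxM.
      by rewrite mulVmx ?map_mx1 ?mul1mx //; apply: (Munit y).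
  - by exists a%:M.
  (* Companion matrix: x shifts the basis, and the last row rewrites x^(n+1) by the monic relation
     p(x) = 0. *)
  rewrite inE => /eqP ->; exists (\matrix_(i < n.+1, j < n.+1)
    if (i < n)%N then (j == i.+1 :> nat)%:R else - p`_j).
  apply/matrixP => i j; rewrite !mxE -exprS; case: (ltnP i n) => [lt_in|le_ni].
    rewrite (bigD1 (Ordinal (lt_in : (i.+1 < n.+1)%N))) //= !mxE lt_in eqxx rmorph1 mul1r.
    rewrite big1 ?addr0 // => k; rewrite !mxE lt_in -val_eqE /= => /negPf ->.
    by rewrite rmorph0 mul0r.
  have ein : i = n :> nat by apply/eqP; rewrite eqn_leq le_ni -ltnS ltn_ord.
  rewrite ein.
  have := px; rewrite (@horner_coef_wide _ n.+2) ?size_map_poly ?sp // big_ord_recr /=.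
  have lp : p`_n.+1 = 1 by rewrite -[n.+1]/(n.+2.-1) -sp -lead_coefE (monicP pm).
  rewrite coef_map /= lp rmorph1 mul1r.
  move=> /eqP; rewrite addrC addr_eq0 => /eqP ->; rewrite -sumrN; apply: eq_bigr => k _.
  by rewrite !mxE ein ltnn coef_map /= rmorphN mulNr.
have [B eB] : exists B : 'M[K]_n.+1, map_mx d b = map_mx iota B *m b.
  have f (i : 'I_n.+1) : {M | hasM (d (x ^+ i)) M}.
    apply: constructive_indefinite_description; apply/exM/dTT/(subfieldX sfT).
    exact: gen_mem1.
  exists (\matrix_(i, j) sval (f i) 0 j); apply/matrixP => i j; rewrite !mxE.
  have /matrixP/(_ 0 j) := svalP (f i); rewrite !mxE expr0 mulr1 => ->.
  by apply: eq_bigr => k _; rewrite !mxE.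
(* Differentiate y b = M b using d b = B b; the commutator accounts for the basis not being
   constant. *)
have Md y M : T y -> hasM y M -> hasM (d y) (map_mx D M + M *m B - B *m M).
  move=> Ty e; have Tx : T x by apply: gen_mem1.
  have Txn k : T (x ^+ k) by apply: subfieldX.
  have e1 : d y *: b + y *: map_mx d b = map_mx iota (map_mx D M) *m b + map_mx iota M *m
    map_mx d b.
    apply/matrixP => i j; have := congr1 (fun C : 'cV_n.+1 => d (C i j)) e.
    rewrite !mxE dU.2 // => ->; rewrite (der_sum sfT dU) => [|k _]; last first.
      by rewrite !mxE; apply: (subfieldM sfT).
    by rewrite -big_split; apply: eq_bigr => k _; rewrite !mxE dU.2 // DE.
  rewrite /hasM raddfB raddfD /= mulmxBl mulmxDl !map_mxM -!mulmxA -eB -e.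
  rewrite -scalemxAr -eB -e1 addrK //.
move=> cS wT w0 vT rS edv.
have exw k : {M | hasM (w k) M} by apply: constructive_indefinite_description; apply: exM.
have [Mv eMv] := exM _ vT.
have exc k : {a | c k = iota a} by apply: constructive_indefinite_description; apply/imS.
have [r0 er0] := (imS r).1 rS.
pose M k := sval (exw k); have eM k : hasM (w k) (M k) by rewrite /M; case: (exw k).
pose a k := sval (exc k); have ea k : c k = iota (a k) by rewrite /a; case: (exc k).
have uM k : M k \in unitmx by apply: Munit (eM k).
have detM k : \det (M k) != 0 by rewrite -unitfE -unitmxE.
have trL k : exists L, hasM (dlog d (w k)) L /\ \tr L = D (\det (M k)) / \det (M k).
  have [|L eL] := exM (dlog d (w k)); first by apply: (subfield_div sfT) => //; apply: dTT.
  exists L; split=> //; have := MM _ _ _ _ (eM k) eL; rewrite mulrC divfK // => e.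
  (* Both M L and the formula of [Md] represent d w; multiplying by the inverse of M reduces the
     trace of L to that of M^-1 D(M). *)
  have := uniqM _ _ _ e (Md _ _ (wT k) (eM k)) => /(congr1 (mulmx (invmx (M k)))).
  rewrite mulKmx // mulmxBr mulmxDr mulKmx // => ->.
  rewrite raddfB raddfD /= mulmxA [\tr (invmx _ *m _ *m M k)]mxtrace_mulC mulKVmx // addrK.
  by rewrite jacobi_formula // /invmx uM -scalemxAl mxtraceZ mulrC.
have exL k := constructive_indefinite_description _ (trL k).
exists n.+1, (iota (\tr Mv)), (fun k => iota (\det (M k))); split=> //.
- by split=> [|k]; [apply/imS; exists (\tr Mv)|rewrite fmorph_eq0; split=> //; apply/imS;
  exists (\det (M k))].
- pose L k := sval (exL k); have eL k := proj1 (svalP (exL k));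
  have tL k := proj2 (svalP (exL k)).
  have H : hasM r (map_mx D Mv + Mv *m B - B *m Mv + \sum_k (a k)%:M *m L k).
    rewrite -edv; apply: (MD); first exact: Md.
    apply: (big_rec2 hasM) => [|k y N _ IH]; first by rewrite /hasM scale0r map_mx0 mul0mx.
    by apply: (MD) => //; rewrite ea; apply: MM => //; apply: eL.
  have Hr := Mi r0; rewrite -er0 in Hr.
  have := congr1 (fun M => iota (\tr M)) (uniqM _ _ _ H Hr).
  rewrite mxtrace_scalar raddfMn /= -er0 -[RHS]mulr_natl => <-.
  rewrite DE raddfD raddfB raddfD /= [\tr (B *m _)]mxtrace_mulC mxtraceD addrK;
    congr (_ + _).
    rewrite (_ : \tr (map_mx D Mv) = D (\tr Mv)) // /mxtrace derivation_sum //.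
    by apply: eq_bigr => i _; rewrite mxE.
  rewrite (raddf_sum (@mxtrace _ _)) raddf_sum /=; apply: eq_bigr => k _;
    rewrite mul_scalar_mx mxtraceZ rmorphM -ea.
  by rewrite (tL k) fmorph_div -DE.
- move=> /imS[z ez]; have := Mi z; rewrite -ez => /(uniqM _ _ _ eMv) ->.
  by rewrite mxtrace_scalar raddfMn /= -ez mulr_natl.
- move=> k /imS[z ez]; have := Mi z; rewrite -ez => /(uniqM _ _ _ (eM k)) ->.
  by rewrite det_scalar rmorphXn /= -ez.
Qed.

End Trace.

Lemma gen_nil (E : fieldType) (S : E -> Prop) : subfield S ->
  forall y, gen S [::] y -> S y.
Proof. by move=> sfS; apply: gen_min. Qed.

Lemma gen_cons_sub (E : fieldType) (S : E -> Prop) x xs y :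
  gen (gen S [:: x]) xs y -> gen S (x :: xs) y.
Proof.
move: y; apply: gen_min; first exact: gen_subfield.
  apply: gen_min; [exact: gen_subfield|by move=> y Sy; apply: gen_base|].
  by move=> y; rewrite inE => /eqP ->; apply: gen_mem; rewrite mem_head.
by move=> y xsy; apply: gen_mem; rewrite inE xsy orbT.
Qed.

Lemma der_alg_gen1 (E : fieldType) (S T : E -> Prop) (x : E) (d : E -> E) :
  [pchar E] =i pred0 -> subfield S -> subfield T -> der_on T d ->
  (forall y, S y -> T y) -> T x ->
  (forall y, S y -> S (d y)) -> algebraic_over S x ->
  forall y, gen S [:: x] y -> gen S [:: x] (d y).
Proof.
move=> ch0 sfS sfT dT ST Tx dS ax; have sfG := gen_subfield S [:: x].
apply: (@der_gen_closed _ S T) => //.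
- apply: gen_min => // y; by rewrite inE => /eqP ->.
- by move=> y; apply: gen_base.
- by move=> y; apply: gen_mem.
- by move=> y /dS; apply: gen_base.
move=> y; rewrite inE => /eqP ->.
apply: (@der_alg_mem _ S T (gen S [:: x]) d) => //; [|by move=> z /dS;
  apply: gen_base|exact: gen_mem1].
by move=> z Sz; split; [apply: ST|apply: gen_base].
Qed.

(* The logarithmic derivative turns norms into traces, so taking the trace of
   the relation replaces v and the w k by elements of S. *)
Lemma trace_gen (E : fieldType) (S : E -> Prop) (xs : seq E) (d : E -> E) m
    (c w : 'I_m -> E) (v r : E) :
  [pchar E] =i pred0 -> subfield S -> (forall x, x \in xs -> algebraic_over S x) ->
  der_on (gen S xs) d -> (forall y, S y -> S (d y)) ->
  (forall k, S (c k)) -> (forall k, gen S xs (w k)) -> (forall k, w k != 0) ->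
  gen S xs v -> S r -> d v + \sum_k c k * dlog d (w k) = r ->
  exists (N : nat) (V : E) (W : 'I_m -> E),
    [/\ (0 < N)%N, S V /\ (forall k, S (W k) /\ W k != 0),
        d V + \sum_k c k * dlog d (W k) = N%:R * r,
        S v -> V = N%:R * v & forall k, S (w k) -> W k = w k ^+ N].
Proof.
move=> ch0; elim: xs S => [|x xs IH] S sfS axs dT dS Sc Tw w0 Tv Sr e.
  exists 1%N, v, w; split=> //; rewrite ?mul1r //.
  by split=> [|k]; [|split=> //]; apply: gen_nil.
have sfG := gen_subfield S [:: x]; have ax := axs x (mem_head _ _).
have GT y : gen S [:: x] y -> gen S (x :: xs) y.
  by move=> Gy; apply/gen_cons_sub/gen_base.
have := IH (gen S [:: x]) sfG _ _ _ _ _ w0 _ _ e; case.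
- move=> y xsy; apply: (@alg_mono _ S) => [z|]; first exact: gen_base.
  by apply: axs; rewrite inE xsy orbT.
- by apply: der_on_sub dT => y; apply: gen_cons_sub.
- apply: (@der_alg_gen1 _ S (gen S (x :: xs))) => //; first exact: gen_subfield.
    by move=> y; apply: gen_base.
  by apply/GT/gen_mem1.
- by move=> k; apply/gen_base/Sc.
- by move=> k; apply/gen_cons/Tw.
- exact: gen_cons.
- exact: gen_base.
move=> N1 [V1 [W1 [N1_gt0 [SV1 SW1] e1 v1 w1]]].
have dG : der_on (gen S [:: x]) d by apply: der_on_sub dT.
have SN n : S n%:R by apply: subfield_nat.
have := @trace_simple E S x d ch0 sfS ax dG dS m c W1 V1 (N1%:R * r) Sc
  (fun k => (SW1 k).1) (fun k => (SW1 k).2) SV1 (subfieldM sfS (SN _) Sr) e1.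
move=> [N2 [V2 [W2 [N2_gt0 SVW e2 v2 w2]]]].
exists (N2 * N1)%N, V2, W2; split=> //; first by rewrite muln_gt0 N2_gt0.
- by rewrite e2 mulrA natrM.
- move=> Sv; have Gv : gen S [:: x] v by apply: gen_base.
  by rewrite v2 v1 ?natrM ?mulrA //; apply: (subfieldM sfS).
move=> k Sw; have Gw : gen S [:: x] (w k) by apply: gen_base.
by rewrite w2 w1 // -?exprM 1?mulnC //; apply: subfieldX.
Qed.

(** * Polynomial parts *)

Section PolynomialPart.

Variables (K E : fieldType) (iota : {rmorphism K -> E}) (t : E).
Variables (T : E -> Prop) (d : E -> E) (D : K -> K) (b c : K).
Hypothesis transc : forall p : {poly K}, (map_poly iota p).[t] = 0 -> p = 0.
Hypotheses (sfT : subfield T) (dT : der_on T d).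
Hypotheses (Ti : forall a, T (iota a)) (Tt : T t).
Hypothesis DE : forall a, d (iota a) = iota (D a).
Hypothesis dtE : d t = iota b + iota c * t.

Local Notation ev p := (map_poly iota p).[t].

Lemma restrict_derivation : derivation D.
Proof.
split=> x y; apply: (fmorph_inj iota); rewrite -DE !(rmorphD, rmorphM) -?DE.
  by rewrite dT.1.
by rewrite dT.2.
Qed.

Let D0 : D 0 = 0 := derivation0 restrict_derivation.
Let D1 : D 1 = 0 := derivation1 restrict_derivation.

Lemma ev_eq0 (p : {poly K}) : (ev p == 0) = (p == 0).
Proof. by apply/eqP/eqP => [/transc//|->]; rewrite rmorph0 horner0. Qed.

Lemma ev_inj (p q : {poly K}) : ev p = ev q -> p = q.
Proof.
move=> e; apply/eqP; rewrite -subr_eq0; apply/eqP/transc.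
by rewrite rmorphB hornerD hornerN e subrr.
Qed.

Lemma evD (p q : {poly K}) : ev (p + q) = ev p + ev q.
Proof. by rewrite rmorphD hornerD. Qed.

Lemma evB (p q : {poly K}) : ev (p - q) = ev p - ev q.
Proof. by rewrite rmorphB hornerD hornerN. Qed.

Lemma evM (p q : {poly K}) : ev (p * q) = ev p * ev q.
Proof. by rewrite rmorphM hornerM. Qed.

Lemma evC a : ev a%:P = iota a.
Proof. by rewrite map_polyC hornerC. Qed.

Lemma evZ a (p : {poly K}) : ev (a *: p) = iota a * ev p.
Proof. by rewrite map_polyZ hornerZ. Qed.

Lemma ev_mem (p : {poly K}) : T (ev p).
Proof. by apply: (subfield_horner sfT) => // i; rewrite coef_map; apply: Ti. Qed.

(** The derivation that [d] induces on K[t]. As b + c t has degree at most one, degrees do not rise.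
    This shape covers a constant t (b = c = 0), a primitive t (c = 0) and the Euler derivation t
    d/dt (b = 0, c = 1). *)
Definition poly_der (p : {poly K}) : {poly K} :=
  map_poly D p + (b%:P + c *: 'X) * p^`().

Lemma coef_poly_der p i :
  (poly_der p)`_i = D p`_i + b * (p`_i.+1 *+ i.+1) + c * (p`_i *+ i).
Proof.
rewrite /poly_der coefD coef_map_id0 // mulrDl coefD coefCM coef_deriv addrA.
by rewrite -scalerAl coefZ coefXM coef_deriv; case: i.
Qed.

Lemma size_poly_der p : (size (poly_der p) <= size p)%N.
Proof.
apply/leq_sizeP => j lej; rewrite coef_poly_der !nth_default ?D0 ?mul0rn ?mulr0 ?addr0 //.
exact: leqW.
Qed.

Lemma der_ev p : d (ev p) = ev (poly_der p).
Proof.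
rewrite (der_horner sfT dT) // => [|i]; last by rewrite coef_map; apply: Ti.
rewrite evD evM evD evC evZ map_polyX hornerX -dtE mulrC deriv_map; congr (_.[_] + _).
by apply/polyP => i;
  rewrite coef_map coef_map_id0 ?(der0 sfT dT) // coef_map DE coef_map_id0.
Qed.

Lemma size_poly_der_monic p : p \is monic ->
  (size (poly_der p - (c * (size p).-1%:R) *: p)%R < size p)%N.
Proof.
move=> pm; have sp : (0 < size p)%N by rewrite size_poly_gt0 monic_neq0.
rewrite -{2}(prednK sp) ltnS; apply/leq_sizeP => j; rewrite leq_eqVlt => /orP[/eqP <-|lt].
  rewrite coefB coef_poly_der coefZ -lead_coefE (monicP pm) D1 prednK //.
  by rewrite nth_default // mul0rn mulr0 !add0r mulr1 subrr.
have lj : (size p <= j)%N by rewrite -(prednK sp).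
by rewrite coefB coef_poly_der coefZ !nth_default ?D0 ?mul0rn ?mulr0 ?addr0 ?subrr // leqW.
Qed.

(* Negative degree in t. *)
Definition small (y : E) : Prop :=
  exists p q : {poly K}, (size p < size q)%N /\ y = ev p / ev q.

Lemma small_neq0 (p q : {poly K}) : (size p < size q)%N -> q != 0.
Proof. by move=> lt; rewrite -size_poly_gt0; apply: leq_ltn_trans lt. Qed.

Lemma small0 : small 0.
Proof. by exists 0, 1; rewrite size_poly0 size_poly1 rmorph0 horner0 mul0r. Qed.

Lemma smallD x y : small x -> small y -> small (x + y).
Proof.
move=> [p [q [lt ->]]] [p' [q' [lt' ->]]]; have q0 := small_neq0 lt;
  have q0' := small_neq0 lt'.
exists (p * q' + p' * q), (q * q'); rewrite evD !evM addf_div ?ev_eq0 //; split=> //.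
rewrite size_mul //; apply: leq_ltn_trans (size_polyD _ _) _.
have := size_polyMleq p q'; have := size_polyMleq p' q; rewrite gtn_max.
move: q0 q0' lt lt'; rewrite -!size_poly_gt0.
move: (size (p * q')%R) (size (p' * q)%R) (size p) (size q) (size p') (size q') => *; lia.
Qed.

Lemma smallZ a y : small y -> small (iota a * y).
Proof.
move=> [p [q [lt ->]]]; exists (a *: p), q; rewrite evZ mulrA; split=> //.
exact: leq_ltn_trans (size_scale_leq _ _) lt.
Qed.

Lemma smallN y : small y -> small (- y).
Proof. by move=> /(smallZ (-1)); rewrite rmorphN rmorph1 mulN1r. Qed.

Lemma small_sum (I : Type) (r : seq I) (P : pred I) (G : I -> E) :
  (forall i, P i -> small (G i)) -> small (\sum_(i <- r | P i) G i).
Proof. by move=> sG; elim/big_rec: _ => [|i x Pi]; [exact: small0|apply: smallD; auto]. Qed.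

Lemma small_ev p : small (ev p) -> p = 0.
Proof.
move=> [r [q [lt e]]]; have q0 := small_neq0 lt.
have /ev_inj er : ev (p * q) = ev r by rewrite evM e divfK ?ev_eq0.
apply/eqP/contraT => p0; move: lt; rewrite -er size_mul //.
by move: p0 q0; rewrite -!size_poly_gt0; move: (size p) (size q) => *; lia.
Qed.

Lemma small_der y : small y -> small (d y).
Proof.
move=> [p [q [lt ->]]]; have q0 := small_neq0 lt.
exists (poly_der p * q - p * poly_der q), (q ^+ 2); split; last first.
  by rewrite (der_div sfT dT) ?ev_eq0 ?der_ev ?evB ?evM //; exact: ev_mem.
rewrite expr2 size_mul //; apply: leq_ltn_trans (size_polyD _ _) _;
  rewrite size_polyN gtn_max.
have := size_polyMleq (poly_der p) q; have := size_polyMleq p (poly_der q).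
have := size_poly_der p; have := size_poly_der q.
move: q0 lt; rewrite -!size_poly_gt0.
move: (size (poly_der p * q)%R) (size (p * poly_der q)%R) => ? ?.
by move: (size (poly_der p)) (size (poly_der q)) (size p) (size q) => *; lia.
Qed.

Lemma small_polynomial_part (p q : {poly K}) : q != 0 ->
  small (ev p / ev q - ev (p %/ q)).
Proof.
move=> q0; exists (p %% q), q; rewrite ltn_modp q0; split=> //.
by rewrite {1}(divp_eq p q) evD evM mulrDl mulfK ?ev_eq0 // addrC addKr.
Qed.

(** Write p = l q with q monic: the leading coefficient of the derivative of q is c times its
    degree, so dlog q equals that number up to negative degree. *)
Lemma small_dlog_ev (p : {poly K}) : p != 0 ->
  small (dlog d (ev p) - (dlog d (iota (lead_coef p)) + iota (c * (size p).-1%:R))).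
Proof.
move=> p0; set l := lead_coef p; have l0 : l != 0 by rewrite lead_coef_eq0.
pose q := l^-1 *: p; have qm : q \is monic by rewrite monicE lead_coefZ mulVf.
have ep : p = l *: q by rewrite scalerA divff // scale1r.
have sq : size q = size p by rewrite size_scale ?invr_eq0.
have q0 := monic_neq0 qm; clearbody q.
exists (poly_der q - (c * (size p).-1%:R) *: q), q; split;
  first by rewrite -sq size_poly_der_monic.
rewrite ep evZ (dlogM dT) ?fmorph_eq0 ?ev_eq0 //; last exact: ev_mem.
rewrite -ep evB evZ -der_ev /dlog; field; by rewrite ev_eq0 q0 fmorph_eq0.
Qed.

Lemma small_dlog (p q : {poly K}) : p != 0 -> q != 0 ->
  small (dlog d (ev p / ev q) - (dlog d (iota (lead_coef p / lead_coef q)) +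
         iota (c * ((size p)%:Z - (size q)%:Z)%:~R))).
Proof.
move=> p0 q0; have := smallD (small_dlog_ev p0) (smallN (small_dlog_ev q0)).
congr small; rewrite fmorph_div.
rewrite (dlogM dT (ev_mem p) (subfieldV sfT (ev_mem q))) ?invr_eq0 ?ev_eq0 //.
rewrite (dlogM dT (Ti _) (subfieldV sfT (Ti _))) ?invr_eq0 ?fmorph_eq0 ?lead_coef_eq0 //.
rewrite (dlogV sfT dT (ev_mem q)) ?ev_eq0 // (dlogV sfT dT (Ti _)) ?fmorph_eq0
  ?lead_coef_eq0 //.
have -> : ((size p)%:Z - (size q)%:Z)%:~R = (size p).-1%:R - (size q).-1%:R :> K.
  move: p0 q0; rewrite -!size_poly_gt0; case: (size p) => // n; case: (size q) => // n' _ _.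
  by rewrite rmorphB /= -!pmulrn -!natr1; ring.
by rewrite mulrBr rmorphB; ring.
Qed.

(** A fraction in t splits uniquely into a polynomial and a part of negative degree, [d] respects
    the splitting, and a logarithmic derivative has a polynomial part of degree 0; so the identity
    may be compared on polynomial parts. The clause on powers of t later supplies a nonzero
    exponent, and the clause on V = 0 keeps a purely logarithmic relation purely logarithmic. *)
Lemma polynomial_part m (a : 'I_m -> K) (W : 'I_m -> E) (V : E) (f : {poly K}) :
  (exists p q, ev q != 0 /\ V = ev p / ev q) ->
  (forall k, W k != 0 /\ exists p q, ev q != 0 /\ W k = ev p / ev q) ->
  ev f = d V + \sum_k iota (a k) * dlog d (W k) ->
  exists (g : {poly K}) (alpha : 'I_m -> K) (n : 'I_m -> int),
    [/\ f = poly_der g + (\sum_k a k * (D (alpha k) / alpha k + c * (n k)%:~R))%:P,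
        forall k, alpha k != 0,
        forall k N, W k = t ^+ N -> n k = N &
        V = 0 -> g = 0].
Proof.
move=> [p [q [q0 eV]]] HW ef.
have exW k : {pq : {poly K} * {poly K} |
    [/\ pq.1 != 0, pq.2 != 0 & W k = ev pq.1 / ev pq.2]}.
  apply: constructive_indefinite_description; have [W0 [u [v [v0 e]]]] := HW k.
  rewrite ev_eq0 in v0; exists (u, v); split=> //=.
  by apply: contraNneq W0 => u0; rewrite e u0 rmorph0 horner0 mul0r.
pose u k := (sval (exW k)).1; pose v k := (sval (exW k)).2.
have Wuv k : [/\ u k != 0, v k != 0 & W k = ev (u k) / ev (v k)].
  by rewrite /u /v; case: (exW k).
(* The polynomial part of [V], then the leading coefficients and degrees of the [W k]; the shift
   between size and degree cancels in the difference. *)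
exists (p %/ q), (fun k => lead_coef (u k) / lead_coef (v k)),
  (fun k => (size (u k))%:Z - (size (v k))%:Z); split.
- apply/eqP; rewrite -subr_eq0; apply/eqP/small_ev; rewrite evB evD evC -der_ev ef.
  have [q0' Tpq] : q != 0 /\ T (ev p / ev q).
    by rewrite -ev_eq0; split=> //; apply: (subfield_div sfT); exact: ev_mem.
  have sV := small_der (small_polynomial_part p q0').
  rewrite (derB sfT dT) // -?eV in sV; last exact: ev_mem.
  have sW : small (\sum_k iota (a k) * (dlog d (W k) -
     (dlog d (iota (lead_coef (u k) / lead_coef (v k))) +
         iota (c * ((size (u k))%:Z - (size (v k))%:Z)%:~R)))).
    apply: small_sum => k _; apply: smallZ; have [u0 v0 ->] := Wuv k.
    exact: small_dlog.
  have := smallD sV sW; congr small.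
  rewrite opprD addrACA; congr (_ + _); rewrite rmorph_sum -sumrB; apply: eq_bigr => k _.
  move: (lead_coef (u k) / lead_coef (v k)) => al.
  have eal z : iota (a k * (D al / al + z)) = iota (a k) * (d (iota al) / iota al + iota z).
    by rewrite DE -fmorph_div -rmorphD -rmorphM.
  by rewrite eal /dlog; ring.
- by move=> k; have [u0 v0 _] := Wuv k; rewrite mulf_neq0 ?invr_eq0 ?lead_coef_eq0.
- move=> k N eN; have [u0 v0] := Wuv k; rewrite eN => e.
  have : ev ('X^N * v k) = ev (u k).
    by rewrite evM map_polyXn hornerXn e divfK // ev_eq0.
  move=> /ev_inj <-; rewrite mulrC size_mulXn //.
  by move: v0; rewrite -size_poly_gt0; move: (size (v k)) => *; lia.
- move=> V0; suff -> : p = 0 by rewrite div0p.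
  by apply/eqP; rewrite -ev_eq0; move/eqP: eV;
    rewrite V0 eq_sym mulf_eq0 invr_eq0 (negPf q0) orbF.
Qed.

End PolynomialPart.

Lemma transc_image (K E : fieldType) (iota : {rmorphism K -> E}) (S : E -> Prop) t :
  (forall x, S x <-> exists z, x = iota z) -> ~ algebraic_over S t ->
  forall p : {poly K}, (map_poly iota p).[t] = 0 -> p = 0.
Proof.
move=> imS ntr p e; apply: NNPP => p0; apply: ntr; apply/(alg_image imS).
by exists p; [apply/eqP|apply/rootP].
Qed.

Lemma der_gen_eq0 (E : fieldType) (S T : E -> Prop) xs (d : E -> E) :
  subfield T -> der_on T d -> (forall y, gen S xs y -> T y) ->
  (forall y, S y -> d y = 0) -> (forall x, x \in xs -> d x = 0) ->
  forall y, gen S xs y -> d y = 0.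
Proof.
move=> sfT dT ST dS dxs y Gy; suff [] : T y /\ d y = 0 by [].
move: y Gy; apply: gen_min => [|x Sx|x xsx].
- split=> [|x y [Tx ex] [Ty ey]|x y [Tx ex] [Ty ey]|x [Tx ex]].
  + by rewrite (der1 sfT dT); split=> //; apply: subfield1.
  + by rewrite (derB sfT dT) // ex ey subrr; split=> //; apply: subfieldB.
  + by rewrite dT.2 // ex ey mul0r mulr0 addr0; split=> //; apply: subfieldM.
  + split; first exact: subfieldV.
    have [->|x0] := eqVneq x 0; first by rewrite invr0 (der0 sfT dT).
    have := der_div sfT dT (subfield1 sfT) Tx x0.
    by rewrite mul1r ex (der1 sfT dT) mul0r mulr0 subrr mul0r.
- by split; [apply/ST/gen_base|apply: dS].
- by split; [apply/ST/gen_mem|apply: dxs].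
Qed.

(** * Logarithmic relations and descent *)

Section LogRelation.

Variables (E : fieldType) (S T C : E -> Prop) (t : E) (d : E -> E).
Hypotheses (ch0 : [pchar E] =i pred0) (sfS : subfield S) (sfT : subfield T).
Hypotheses (sfC : subfield C) (CS : forall y, C y -> S y) (ST : forall y, S y -> T y).
Hypotheses (dT : der_on T d) (dS : forall y, S y -> d y = 0).
Hypotheses (Tt : T t) (dt0 : d t != 0).
Hypothesis Talg : forall y, T y -> algebraic_over (gen S [:: t]) y.

Lemma alg_over_transc x y : T x -> ~ algebraic_over S x -> T y ->
  algebraic_over (gen S [:: x]) y.
Proof.
move=> Tx xtr Ty; apply: (@alg_trans_gen _ _ [:: t]); first exact: gen_subfield.
  by move=> z; rewrite inE => /eqP ->; apply: exchange => //; apply: Talg.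
apply: alg_mono (Talg Ty); apply: gen_min; first exact: gen_subfield.
  by move=> z Sz; do 2!apply: gen_base.
by move=> z; apply: gen_mem.
Qed.

(** [T] has transcendence degree one over [S]: a transcendental x with d x = 0 would make t
    algebraic over S(x), where d vanishes, against [dt0]. *)
Lemma der_eq0_alg x : T x -> d x = 0 -> algebraic_over S x.
Proof.
move=> Tx dx; apply: NNPP => xtr; case/eqP: dt0.
have GT y : gen S [:: x] y -> T y.
  by move: y; apply: gen_min => // y; rewrite inE => /eqP ->.
apply: (@der_alg_eq0 _ (gen S [:: x]) T) => //;
  [exact: gen_subfield| |exact: alg_over_transc].
by apply: (@der_gen_eq0 _ S T) => // y; rewrite inE => /eqP ->.
Qed.

(* After a norm down to S(w k0), where w k0 becomes (w k0)^N, compare the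
   degrees in w k0 of both sides. *)
Lemma log_relation_int m (c w : 'I_m -> E) (v : E) k0 :
  (forall k, C (c k)) -> (forall k, T (w k)) -> (forall k, w k != 0) -> T v ->
  d v + \sum_k c k * dlog d (w k) = 0 -> ~ algebraic_over S (w k0) ->
  exists2 n : 'I_m -> int, n k0 != 0 & \sum_k c k * (n k)%:~R = 0.
Proof.
move=> Cc Tw w0 Tv e tr; set x := w k0; have Tx : T x by apply: Tw.
have dx0 : d x != 0 by apply/eqP => /(der_eq0_alg Tx).
pose R := gen S [:: x]; have sfR : subfield R by apply: gen_subfield.
have RT y : R y -> T y.
  by move: y; apply: gen_min => // y; rewrite inE => /eqP ->.
(* [th] restricts to x d/dx on S(x), so the logarithmic derivative of x^N is N. *)
pose th y := x / d x * d y.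
have thT : der_on T th.
  by split=> y z Ty Tz; rewrite /th ?dT.1 // ?dT.2 //; ring.
have thx : th x = x by rewrite /th divfK.
have thS y : S y -> th y = 0 by move=> Sy; rewrite /th (dS Sy) mulr0.
have thR y : R y -> R (th y).
  apply: (@der_gen_closed _ S T) => //.
  - by move=> z; apply: gen_base.
  - by move=> z; apply: gen_mem.
  - by move=> z /thS ->; apply: subfield0.
  - by move=> z; rewrite inE => /eqP ->; rewrite thx; apply: gen_mem1.
have the : th v + \sum_k c k * dlog th (w k) = 0.
  transitivity (x / d x * (d v + \sum_k c k * dlog d (w k))); last by rewrite e mulr0.
  rewrite mulrDr mulr_sumr; congr (_ + _); apply: eq_bigr => k _.
  by rewrite /dlog /th; ring.
pose xs := v :: codom w.
have Txs y : y \in xs -> T y.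
  by rewrite inE => /orP[/eqP ->|/codomP[k ->]].
have RxsT y : gen R xs y -> T y by move: y; apply: gen_min.
have := @trace_gen E R xs th m c w v 0 ch0 sfR _ (der_on_sub RxsT thT) thR _ _ w0 _ _ the.
case.
- by move=> y /Txs; apply: alg_over_transc.
- by move=> k; apply/gen_base/CS.
- by move=> k; apply: gen_mem; rewrite inE codom_f orbT.
- by apply: gen_mem; rewrite mem_head.
- exact: subfield0.
move=> N [V [W [N_gt0 [RV RW] eVW _ wN]]].
have [K [iota imS]] := subfield_image sfS.
have Si a : S (iota a) by apply/imS; exists a.
have exc k : {a | c k = iota a}.
  by apply: constructive_indefinite_description; apply/imS/CS.
have thE a : th (iota a) = iota 0 by rewrite thS // rmorph0.
have thx' : th x = iota 0 + iota 1 * x by rewrite rmorph0 rmorph1 mul1r add0r.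
have := polynomial_part (transc_image imS tr) sfT thT (fun a => ST (Si a)) Tx thE thx'.
move=> /(_ m (fun k => sval (exc k)) W V 0 (gen1_frac imS RV)) [].
- by move=> k; have [RWk Wk0] := RW k; split=> //; apply: (gen1_frac imS).
- rewrite rmorph0 horner0 -[LHS](mulr0 N%:R) -eVW; congr (_ + _); apply: eq_bigr => k _.
  by case: (exc k) => a /= ->.
move=> g [al [n [/polyP/(_ 0) eg _ nN _]]]; exists n.
  have -> : n k0 = N by apply: nN; apply: wN; exact: gen_mem1.
  by case: N N_gt0 {eVW wN nN}.
(* In the constant coefficient [poly_der g] contributes nothing, because [th] kills [S]; only the
   sum of the c_k n_k remains. *)
move: eg; rewrite coef0 coefD coefC /= (coef_poly_der _ _ thT (fun a => ST (Si a)) thE).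
rewrite mul0r mulr0n mulr0 !addr0 add0r => /(congr1 iota).
rewrite rmorph0 rmorph_sum /= => eg; rewrite [RHS]eg; apply: eq_bigr => k _.
by case: (exc k) => a /= ->; rewrite mul0r add0r mul1r rmorphM rmorph_int.
Qed.

(** An integer relation with n_k0 nonzero expresses c_k0 through the other coefficients and so
    removes one logarithm; induct on m. The equality of sums is kept for every derivation of [T],
    since the same form must afterwards be evaluated at delta and at each of the given
    derivations. *)
Lemma log_relation_alg m (c w : 'I_m -> E) (v : E) :
  (forall k, C (c k)) -> (forall k, T (w k)) -> (forall k, w k != 0) -> T v ->
  d v + \sum_k c k * dlog d (w k) = 0 ->
  algebraic_over S v /\ exists m' (c' w' : 'I_m' -> E),
    (forall k, [/\ C (c' k), w' k != 0 & algebraic_over S (w' k)]) /\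
    forall e, der_on T e ->
      \sum_k c k * dlog e (w k) = \sum_k c' k * dlog e (w' k).
Proof.
elim: m c w => [|m IH] c w Cc Tw w0 Tv eq0.
  have dv : d v = 0 by rewrite -[RHS]eq0 big_ord0 addr0.
  split; first exact: der_eq0_alg.
  by exists 0%N, c, w; split=> // -[].
have [walg|/not_all_ex_not[k0 tr]] := classic (forall k, algebraic_over S (w k)).
  split; last by exists m.+1, c, w.
  apply: der_eq0_alg => //; rewrite -[RHS]eq0 big1 ?addr0 // => k _.
  by rewrite /dlog (der_alg_eq0 ch0 sfS sfT dT) ?mul0r ?mulr0.
have [n n0 en] := log_relation_int Cc Tw w0 Tv eq0 tr.
have N0 : (n k0)%:~R != 0 :> E.
  have /pcharf0P ch := ch0; case: (n k0) n0 => a a0; first by rewrite -pmulrn ch.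
  by rewrite NegzE mulrNz oppr_eq0 -pmulrn ch.
(* The sum of the c_k log w_k equals the sum over j <> k0 of (c_j / n_k0) log (w_j^n_k0
   w_k0^-n_j). *)
pose c' j := c (lift k0 j) / (n k0)%:~R.
pose w' j := w (lift k0 j) ^ n k0 * w k0 ^ (- n (lift k0 j)).
have Tw' j : T (w' j) by apply: (subfieldM sfT); apply: subfieldXz.
have w0' j : w' j != 0 by rewrite mulf_neq0 ?expfz_neq0.
have Cc' j : C (c' j) by apply: (subfield_div sfC) => //; apply: subfield_int.
have step e : der_on T e -> \sum_k c k * dlog e (w k) = \sum_j c' j * dlog e (w' j).
  move=> eT; have c0E : c k0 = - (\sum_j c (lift k0 j) * (n (lift k0 j))%:~R) / (n k0)%:~R.
    apply: (canRL (mulfK N0)); apply/eqP; rewrite -addr_eq0 -[X in _ == X]en.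
    by rewrite [X in _ == X](bigD1_ord k0).
  rewrite (bigD1_ord k0) //= c0E mulNr mulNr 2!mulr_suml -sumrN -big_split /=.
  apply: eq_bigr => j _; rewrite /c' /w' (dlogM eT) ?expfz_neq0 //; try exact: subfieldXz.
  by rewrite !(dlogXz sfT eT) // mulrNz; field.
have [|av [m' [c1 [w1 [H1 H2]]]]] := IH c' w' Cc' Tw' w0' Tv; first by rewrite -step.
split=> //; exists m', c1, w1; split=> // e eT.
by rewrite step // H2.
Qed.

End LogRelation.

(** * Descent of a form through one transcendental generator *)

Section Descent.

Variables (E : fieldType) (S C : E -> Prop) (t : E) (delta : E -> E).
Hypotheses (ch0 : [pchar E] =i pred0) (sfS : subfield S) (sfC : subfield C).
Hypotheses (CS : forall y, C y -> S y) (deltaD : derivation delta).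
Hypotheses (deltaC : forall y, C y -> delta y = 0) (deltaS : forall y, S y -> S (delta y)).
Hypothesis ttr : ~ algebraic_over S t.
Hypothesis constC :
  forall y, algebraic_over (gen S [:: t]) y -> delta y = 0 -> C y.

Variables (m : nat) (c w : 'I_m -> E) (v : E).
Hypotheses (Cc : forall k, C (c k)) (w0 : forall k, w k != 0).
Hypotheses (walg : forall k, algebraic_over (gen S [:: t]) (w k)).
Hypothesis valg : algebraic_over (gen S [:: t]) v.
Hypothesis relation : delta v + \sum_k c k * dlog delta (w k) = 0.

(* d, the extension of z d/dt, commutes with delta, so h = d v + sum c d w / w
   is a constant of delta. *)
Lemma commuting_derivation (z : E) :
  gen S [:: t] (delta t) -> gen S [:: t] z ->
  (forall d, der_on (gen S [:: t]) d -> (forall y, S y -> d y = 0) -> d t = z ->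
     d (delta t) = delta z) ->
  exists (T : E -> Prop) (d : E -> E),
    [/\ subfield T, der_on T d,
        [/\ forall y, gen S [:: t] y -> T y,
            forall y, T y -> algebraic_over (gen S [:: t]) y,
            T v & forall k, T (w k)],
        (forall y, S y -> d y = 0) /\ d t = z
      & C (d v + \sum_k c k * dlog d (w k))].
Proof.
set G := gen S [:: t] => Gdt Gz dz; have sfG : subfield G by apply: gen_subfield.
have SG y : S y -> G y by apply: gen_base.
have Gt : G t by apply: gen_mem1.
have dS0 : der_on S (fun=> 0) by split=> *; rewrite ?mulr0 ?mul0r addr0.
have [d1 d1G [d1S d1t]] := der_extend_transc z sfS dS0 ttr.
pose xs := v :: codom w.
have axs y : y \in xs -> algebraic_over G y.
  by rewrite inE => /orP[/eqP ->//|/codomP[k ->]].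
have [d dT dG] := der_extend_alg ch0 sfG d1G axs.
set T := gen G xs in dT; have sfT : subfield T by apply: gen_subfield.
have GT y : G y -> T y by apply: gen_base.
have Talg y : T y -> algebraic_over G y by apply: alg_gen.
have dS y : S y -> d y = 0 by move=> Sy; rewrite dG ?d1S //; apply: SG.
have dt : d t = z by rewrite dG.
have closed e : der_on T e -> (forall y, S y -> G (e y)) -> G (e t) ->
    forall y, T y -> T (e y).
  move=> eT eS et; have eG y : G y -> G (e y).
    apply: (@der_gen_closed _ S T) => // x; rewrite inE => /eqP -> //.
  apply: (@der_gen_closed _ G T) => //.
  - by move=> x; apply: gen_mem.
  - by move=> y /eG; apply: GT.
  - move=> x xsx; apply: (@der_alg_mem _ G T T) => //;
    [by move=> y /GT|by move=> y /eG /GT|..|exact: axs];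
      exact: gen_mem.
have deltaT : der_on T delta := derivation_der_on T deltaD.
have delta_cl := closed delta deltaT (fun y Sy => SG _ (deltaS Sy)) Gdt.
have d_cl : forall y, T y -> T (d y).
  by apply: closed => //; rewrite ?dt // => y /dS ->; apply: subfield0.
(* The commutator is a derivation of [T] that vanishes on [S] and at t, hence on all of [T], which
   is algebraic over S(t). *)
have comm y : T y -> d (delta y) = delta (d y).
  move=> Ty; apply/eqP; rewrite -subr_eq0; apply/eqP; move: y Ty.
  have cT := der_comp_comm sfT dT deltaT d_cl delta_cl.
  move=> y Ty; apply: (@der_alg_eq0 _ G T (fun y => d (delta y) - delta (d y))) => //;
    last exact: Talg.
  apply: (@der_gen_eq0 _ S T) => // x.
    by move=> Sx; rewrite !dS ?(derivation0 deltaD) ?subrr //; apply: deltaS.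
  rewrite inE => /eqP ->; rewrite dt (dz d) ?subrr //.
  by apply: der_on_sub dT.
have Tv : T v by apply: gen_mem; rewrite mem_head.
have Tw k : T (w k) by apply: gen_mem; rewrite inE codom_f orbT.
have Tc k : T (c k) by apply/GT/SG/CS.
exists T, d; split=> //.
have Tdlog e k : (forall y, T y -> T (e y)) -> T (dlog e (w k)).
  by move=> eT; apply: (subfield_div sfT) => //; apply: eT.
apply: constC.
  apply: Talg; apply: (subfieldD sfT); first exact: d_cl.
  by apply: (subfield_sum sfT) => k _; apply: (subfieldM sfT) => //; apply: Tdlog.
have dsum e f : der_on T e -> (forall y, T y -> T (f y)) -> (forall y, C y -> e y = 0) ->
    e (f v + \sum_k c k * dlog f (w k)) = e (f v) + \sum_k c k * e (dlog f (w k)).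
  move=> eT fT eC; rewrite eT.1; [|exact: fT|]; last first.
    by apply: (subfield_sum sfT) => k _; apply: (subfieldM sfT) => //; apply: Tdlog.
  rewrite (der_sum sfT eT) => [|k _]; last by apply: (subfieldM sfT) => //; apply: Tdlog.
  congr (_ + _); apply: eq_bigr => k _;
    exact: (der_mulc eT (Tc k) (Tdlog f k fT) (eC _ (Cc k))).
rewrite dsum // -comm //.
transitivity (d (delta v + \sum_k c k * dlog delta (w k)));
  last by rewrite relation (der0 sfT dT).
rewrite dsum // => [|y /CS/dS //]; congr (_ + _); apply: eq_bigr => k _; congr (_ * _).
rewrite /dlog (der_div sfT dT) ?(der_div sfT deltaT) //;
  try by [exact: d_cl|exact: delta_cl].
by rewrite comm //; ring.
Qed.

(** For z = 1 the commutation condition reads d (delta t) = 0, true because d kills [S]. Since d (h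
    t) = h, replacing v by v - h t gives a form that d annihilates, as [log_relation_alg]
    requires. *)
Lemma descent_primitive : S (delta t) ->
  exists (h v' : E) m' (c' w' : 'I_m' -> E),
    [/\ C h, v = v' + h * t, algebraic_over S v',
        forall k, [/\ C (c' k), w' k != 0 & algebraic_over S (w' k)]
      & forall e, derivation e ->
          \sum_k c k * dlog e (w k) = \sum_k c' k * dlog e (w' k)].
Proof.
move=> Sdt; have sfG := gen_subfield S [:: t].
have [|||T [d [sfT dT [GT Talg Tv Tw] [dS dt] Ch]]] := @commuting_derivation 1.
- exact: gen_base.
- exact: subfield1.
- by move=> d dG dS _; rewrite dS // (derivation1 deltaD).
set h := d v + _ in Ch.
have Tt : T t by apply/GT/gen_mem1.
have ST y : S y -> T y by move=> Sy; apply/GT/gen_base.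
have Th : T h by apply/ST/CS.
have [|||av [m' [c' [w' [H1 H2]]]]] := log_relation_alg ch0 sfS sfT sfC CS ST dT dS Tt _
  Talg Cc Tw w0 (v := v - h * t).
- by rewrite dt oner_neq0.
- by apply: (subfieldB sfT) => //; apply: (subfieldM sfT).
- rewrite (derB sfT dT) //; last exact: (subfieldM sfT).
  by rewrite (der_mulc dT Th Tt (dS _ (CS Ch))) dt mulr1 addrAC -/h subrr.
exists h, (v - h * t), m', c', w'; split=> //; first by rewrite subrK.
by move=> e eD; apply: H2; apply: derivation_der_on.
Qed.

(** For z = t both sides of the commutation condition are b t. Since d t / t = 1, the constant h is
    cancelled by an extra logarithm - h log t, and v itself becomes algebraic over [S]. *)
Lemma descent_exponential b : S b -> delta t = b * t ->
  exists (h : E) m' (c' w' : 'I_m' -> E),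
    [/\ C h, algebraic_over S v,
        forall k, [/\ C (c' k), w' k != 0 & algebraic_over S (w' k)]
      & forall e, derivation e ->
          \sum_k c k * dlog e (w k) = h * dlog e t + \sum_k c' k * dlog e (w' k)].
Proof.
move=> Sb edt; have sfG := gen_subfield S [:: t].
have Gt : gen S [:: t] t by apply: gen_mem1.
have t0 : t != 0.
  by apply/eqP => t0; apply: ttr; rewrite t0; apply: alg_base => //; apply: subfield0.
have [|||T [d [sfT dT [GT Talg Tv Tw] [dS dt] Ch]]] := @commuting_derivation t.
- by rewrite edt; apply: (subfieldM sfG) => //; apply: gen_base.
- by [].
- by move=> d dG dS dt; rewrite edt (der_mulc dG) ?dt ?dS //; apply: gen_base.
set h := d v + _ in Ch.
have Tt : T t by apply/GT.
have ST y : S y -> T y by move=> Sy; apply/GT/gen_base.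
pose c1 (k : 'I_m.+1) := if unlift ord0 k is Some j then c j else - h.
pose w1 (k : 'I_m.+1) := if unlift ord0 k is Some j then w j else t.
have sum1 e : \sum_k c1 k * dlog e (w1 k) = - h * dlog e t + \sum_k c k * dlog e (w k).
  rewrite big_ord_recl /c1 /w1 unlift_none; congr (_ + _).
  by apply: eq_bigr => k _; rewrite liftK.
have [||||||av [m' [c' [w' [H1 H2]]]]] := @log_relation_alg E S T C t d ch0 sfS sfT sfC
  CS ST dT dS Tt _ Talg _ c1 w1 v.
- by rewrite dt.
- by move=> k; rewrite /c1; case: unliftP => // _; apply: (subfieldN sfC).
- by move=> k; rewrite /w1; case: unliftP.
- by move=> k; rewrite /w1; case: unliftP.
- by [].
- rewrite sum1 addrCA -/h /dlog dt divff // mulr1 addNr //.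
exists h, m', c', w'; split=> // e eD.
rewrite -H2; last exact: derivation_der_on.
by rewrite sum1 mulNr addNKr.
Qed.

End Descent.

(** * Origin of the form, and one step of the tower *)

Lemma restrict_der (K E : fieldType) (iota : {rmorphism K -> E}) (S : E -> Prop) (d : E
  -> E) :
  (forall x, S x <-> exists z, x = iota z) -> (forall y, S y -> S (d y)) ->
  exists D : K -> K, forall a, d (iota a) = iota (D a).
Proof.
move=> imS dS; have exD a : {b | d (iota a) = iota b}.
  by apply: constructive_indefinite_description; apply/imS/dS/imS; exists a.
by exists (fun a => sval (exD a)) => a; case: (exD a).
Qed.

(** As t is algebraic over S(x), a trace brings the relation into S(x). There delta acts on
    coefficients alone, x being constant, so comparing polynomial parts in x and then their constant
    terms lands in [S]. *)
Lemma constant_extension_trace (E : fieldType) (S : E -> Prop) (x t : E) (delta : E -> E)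
    m (c w : 'I_m -> E) (v r : E) :
  [pchar E] =i pred0 -> subfield S -> derivation delta ->
  (forall y, S y -> S (delta y)) -> ~ algebraic_over S x -> delta x = 0 ->
  algebraic_over (gen S [:: x]) t -> (forall k, S (c k)) ->
  (forall k, gen S [:: t] (w k)) -> (forall k, w k != 0) -> gen S [:: t] v -> S r ->
  delta v + \sum_k c k * dlog delta (w k) = r ->
  exists (N : nat) (g : E) (alpha : 'I_m -> E),
    [/\ (0 < N)%N, S g, forall k, S (alpha k) /\ alpha k != 0,
        delta g + \sum_k c k * dlog delta (alpha k) = N%:R * r & v = 0 -> g = 0].
Proof.
move=> ch0 sfS dD dS xtr dx talg Sc Tw w0 Tv Sr e.
pose R := gen S [:: x]; have sfR : subfield R by apply: gen_subfield.
have SR y : S y -> R y by apply: gen_base.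
have Rt y : gen S [:: t] y -> gen R [:: t] y.
  move: y; apply: gen_min; first exact: gen_subfield.
    by move=> y /SR; apply: gen_base.
  by move=> y; apply: gen_mem.
have derT T := derivation_der_on T dD.
have dR y : R y -> R (delta y).
  apply: (@der_gen_closed _ S R) => //.
  - by move=> z; apply: gen_mem.
  - by move=> z /dS /SR.
  - by move=> z; rewrite inE => /eqP ->; rewrite dx; apply: subfield0.
have := @trace_gen E R [:: t] delta m c w v r ch0 sfR _ (derT _) dR _ _ w0 _ _ e; case;
  auto.
  by move=> y; rewrite inE => /eqP ->.
move=> N [V [W [N_gt0 [RV RW] eN vN _]]].
have [K [iota imS]] := subfield_image sfS.
have Si a : S (iota a) by apply/imS; exists a.
have [D DE] := restrict_der imS dS.
have exc k : {a | c k = iota a}.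
  by apply: constructive_indefinite_description; apply/imS.
have [r0 er0] := (imS r).1 Sr.
have Rx : R x by apply: gen_mem1.
have dxE : delta x = iota 0 + iota 0 * x by rewrite dx rmorph0 mul0r addr0.
have := polynomial_part (transc_image imS xtr) sfR (derT R) (fun a => SR _ (Si a)) Rx DE
  dxE.
move=> /(_ m (fun k => sval (exc k)) W V (N%:R * r0)%:P (gen1_frac imS RV)) [].
- by move=> k; have [RWk Wk0] := RW k; split=> //; apply: (gen1_frac imS).
- rewrite map_polyC hornerC /= rmorphM rmorph_nat -er0 -eN; congr (_ + _).
  by apply: eq_bigr => k _; case: (exc k) => a /= ->.
move=> g [al [n [/polyP/(_ 0) eg al0 _ g0]]].
exists N, (iota g`_0), (fun k => iota (al k)); split=> //; first by move=> k;
  rewrite fmorph_eq0.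
- move: eg; rewrite coefD !coefC /= (coef_poly_der _ _ (derT R) (fun a => SR _ (Si a)) DE).
  rewrite !mul0r !addr0 => /(congr1 iota); rewrite rmorphM rmorph_nat -er0 => ->.
  rewrite rmorphD rmorph_sum /= -DE; congr (_ + _); apply: eq_bigr => k _.
  by case: (exc k) => a /= ->; rewrite mul0r addr0 rmorphM fmorph_div -DE.
by move=> v0; rewrite g0 ?coef0 ?rmorph0 // vN v0 ?mulr0 //; apply: (subfield0 sfR).
Qed.

(* v + sum_k c_k log w_k is a formal first integral: its differential vanishes on
   delta but not on all the d i. *)
Definition nontrivial_relation (I : Type) (E : fieldType) (d : I -> E -> E)
    (delta : E -> E) (C S : E -> Prop) : Prop :=
  exists m (c w : 'I_m -> E) (v : E),
    [/\ forall k, [/\ C (c k), w k != 0 & algebraic_over S (w k)],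
        algebraic_over S v,
        delta v + \sum_k c k * dlog delta (w k) = 0
      & exists i, d i v + \sum_k c k * dlog (d i) (w k) != 0].

Section Steps.

Variables (I : Type) (E : fieldType) (d : I -> E -> E) (delta : E -> E).
Variables (C S : E -> Prop) (t : E).
Hypotheses (ch0 : [pchar E] =i pred0) (dD : forall i, derivation (d i)).
Hypothesis deltaD : derivation delta.
Hypothesis delta_lin :
  forall x y a, (forall i, d i x = a * d i y) -> delta x = a * delta y.
Hypotheses (sfC : subfield C) (Cd : forall x, C x -> forall i, d i x = 0).
Hypothesis dC : forall x, (forall i, d i x = 0) -> C x.
Hypotheses (sfS : subfield S) (CS : forall y, C y -> S y).
Hypothesis deltaS : forall y, S y -> S (delta y).
Hypothesis tstep : elementary_step d S t.

Let deltaC x : C x -> delta x = 0.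
Proof.
move=> Cx; rewrite (@delta_lin x 0 0) ?mul0r // => i.
by rewrite mul0r Cd.
Qed.

Let sum_cons m (c w : 'I_m -> E) c0 w0 :
  exists c' w' : 'I_m.+1 -> E,
    (forall P : E -> E -> Prop, P c0 w0 -> (forall k, P (c k) (w k)) ->
       forall k, P (c' k) (w' k)) /\
    forall e, \sum_k c' k * dlog e (w' k) = c0 * dlog e w0 + \sum_k c k * dlog e (w k).
Proof.
exists (fun k => if unlift ord0 k is Some j then c j else c0),
       (fun k => if unlift ord0 k is Some j then w j else w0); split.
  by move=> P P0 Pk k; case: unliftP.
move=> e; rewrite big_ord_recl unlift_none; congr (_ + _).
by apply: eq_bigr => k _; rewrite liftK.
Qed.

(** What the descent splits off is re-expressed by data of [S]: for an exponential h dt/t = h da is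
    absorbed into v, for a logarithm h dt = h da/a becomes one more logarithm. The form keeps its
    value on each of the derivations, so it stays nontrivial. *)
Lemma relation_descent :
  (forall y, algebraic_over (gen S [:: t]) y -> delta y = 0 -> C y) ->
  nontrivial_relation d delta C (gen S [:: t]) -> nontrivial_relation d delta C S.
Proof.
move=> constC [m [c [w [v [Hk valg rel [i0 nz]]]]]].
have derT T e : derivation e -> der_on T e by apply: derivation_der_on.
have [talg|ttr] := classic (algebraic_over S t).
  exists m, c, w, v; split=> //; last by exists i0.
    move=> k; have [Ck wk wa] := Hk k; split=> //.
    by apply: alg_trans_gen wa => // y; rewrite inE => /eqP ->.
  by apply: alg_trans_gen valg => // y; rewrite inE => /eqP ->.
have Cc k : C (c k) by have [] := Hk k.
have w0 k : w k != 0 by have [] := Hk k.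
have walg k : algebraic_over (gen S [:: t]) (w k) by have [] := Hk k.
case: tstep => a Sa [//|dt|[a0 dt]].
  have edt : delta t = delta a * t.
    by rewrite (@delta_lin t a t) 1?mulrC // => i; rewrite dt mulrC.
  have t0 : t != 0.
    by apply/eqP => t0; apply: ttr; rewrite t0; apply: alg_base => //; apply: subfield0.
  have [h [m' [c' [w' [Ch va H1 H2]]]]] := descent_exponential ch0 sfS sfC CS deltaD deltaC
    deltaS ttr constC Cc w0 walg valg rel (deltaS Sa) edt.
  have eq e : derivation e -> e h = 0 -> e t = e a * t ->
      e v + \sum_k c k * dlog e (w k) = e (v + h * a) + \sum_k c' k * dlog e (w' k).
    move=> eD eh et; rewrite H2 // eD.1 eD.2 eh mul0r add0r {1}/dlog et mulfK //.
    by rewrite addrA.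
  exists m', c', w', (v + h * a); split=> //.
  - apply: (subfieldD (alg_subfield sfS)) => //; apply: alg_base => //.
    by apply: (subfieldM sfS) => //; apply: CS.
  - by rewrite -eq // deltaC.
  - by exists i0; rewrite -eq // Cd.
have edt : delta t = delta a / a.
  by rewrite (@delta_lin t a a^-1) 1?mulrC // => i; rewrite dt mulrC.
have [|h [v' [m' [c' [w' [Ch ev va H1 H2]]]]]] := descent_primitive ch0 sfS sfC CS deltaD
    deltaC deltaS ttr constC Cc w0 walg valg rel.
  by rewrite edt; apply: (subfield_div sfS) => //; apply: deltaS.
have [c1 [w1 [Hcw Hsum]]] := sum_cons c' w' h a.
have eq e : derivation e -> e h = 0 -> e t = e a / a ->
    e v + \sum_k c k * dlog e (w k) = e v' + \sum_k c1 k * dlog e (w1 k).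
  by move=> eD eh et; rewrite Hsum H2 // ev eD.1 eD.2 eh et /dlog; ring.
exists m'.+1, c1, w1, v'; split=> //.
- move=> k; apply: (Hcw (fun c w => [/\ C c, w != 0 & algebraic_over S w])) => //.
  by split=> //; apply: alg_base.
- by rewrite -eq // deltaC.
- by exists i0; rewrite -eq // Cd.
Qed.

(** The forms are N da - db/b when t is an exponential of a, and dg - N da/a when t is a logarithm
    of a, with N and b or g supplied by the trace. If all the [d i] killed such a form, t^N / b or g
    - N t would be a common constant, hence lie in [S], and t would be algebraic. *)
Lemma new_constant_relation x :
  (forall y, algebraic_over S y -> delta y = 0 -> C y) ->
  algebraic_over (gen S [:: t]) x -> delta x = 0 -> ~ C x ->
  nontrivial_relation d delta C S.
Proof.
move=> constC xalg dx nCx.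
have xtr : ~ algebraic_over S x by move=> /constC; auto.
have ttr : ~ algebraic_over S t.
  by move=> ta; apply: xtr; apply: alg_trans_gen xalg => // y; rewrite inE => /eqP ->.
have talg := exchange sfS xalg xtr.
(* Both proofs of nontriviality end by contradicting this, with exponent 1 for a logarithm. *)
have nS y N : (0 < N)%N -> S y -> t ^+ N != y.
  move=> N0 Sy; apply/eqP => e; apply: ttr; apply: alg_trans => //.
  have sfA := alg_subfield sfS.
  exists ('X^N - y%:P); split.
  - by rewrite -size_poly_eq0 size_XnsubC.
  - move=> i; rewrite coefB coefXn coefC; apply: (subfieldB sfA).
      by apply/alg_base => //; exact: subfield_nat.
    by case: eqP => _; [apply: alg_base|exact: subfield0].
  by rewrite /root !hornerE e subrr.
have one_lt N : (0 < N)%N -> N%:R != 0 :> E by apply: pchar0_natr.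
have CN N : C N%:R by apply: subfield_nat.
have dN i N : d i N%:R = 0 by apply: Cd.
have allP (P : I -> E) : ~ (exists i, P i != 0) -> forall i, P i = 0.
  by move=> H i; apply: NNPP => Pi; apply: H; exists i; apply/eqP.
case: tstep => a Sa [//|dt|[a0 dt]].
  have edt : delta t = delta a * t.
    by rewrite (@delta_lin t a t) 1?mulrC // => i; rewrite dt mulrC.
  have t0 : t != 0.
    by apply/eqP => t0; apply: ttr; rewrite t0; apply: alg_base => //; apply: subfield0.
  have [||||||N [g [al [N0 Sg Sal eN g0]]]] := @constant_extension_trace E S x t delta 1
    (fun=> 1) (fun=> t) 0 (delta a) ch0 sfS deltaD deltaS xtr dx talg.
  - by move=> _; apply: subfield1.
  - by move=> _; apply: gen_mem1.
  - by [].
  - by apply: subfield0; apply: gen_subfield.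
  - exact: deltaS.
  - by rewrite big_ord1 mul1r (derivation0 deltaD) add0r /dlog edt mulfK.
  have [Sb b0] := Sal ord0; set b := al ord0 in Sb b0.
  exists 1%N, (fun=> -1), (fun=> b), (N%:R * a); split.
  - move=> _; split=> //; first by apply: (subfieldN sfC); apply: subfield1.
    exact: alg_base.
  - by apply: alg_base => //; apply: (subfieldM sfS) => //; apply: CS.
  - rewrite big_ord1 deltaD.2 (deltaC (CN N)) mul0r add0r -eN g0 // (derivation0 deltaD).
    by rewrite big_ord1 add0r mul1r mulN1r subrr.
  apply: NNPP => /allP ez.
  have /eqP : t ^+ N / b != 0 by rewrite mulf_neq0 ?invr_eq0 ?expf_neq0.
  suff Cy : C (t ^+ N / b).
    have := nS (t ^+ N / b * b) N N0; rewrite divfK // eqxx => H _.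
    suff // : false by []. apply: H.
    by rewrite -[t ^+ N](divfK b0); apply: (subfieldM sfS) => //; apply: CS.
  apply: dC => i; have dT := derivation_der_on (fun=> True) (dD i).
  have sfT : subfield (fun _ : E => True) by [].
  apply/eqP; rewrite -[_ == 0]orbF.
  have := ez i; rewrite big_ord1 (dD i).2 dN mul0r add0r mulN1r => {}ez.
  have tb0 : t ^+ N / b != 0 by rewrite mulf_neq0 ?invr_eq0 ?expf_neq0.
  have : dlog (d i) (t ^+ N / b) = 0.
    rewrite (dlogM dT) ?invr_eq0 ?expf_neq0 // (dlogV sfT dT) // (dlogX sfT dT) //.
    by rewrite {1}/dlog dt mulfK.
  by rewrite /dlog => /eqP; rewrite mulf_eq0 invr_eq0 (negPf tb0) orbF => ->.
have edt : delta t = delta a / a.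
  by rewrite (@delta_lin t a a^-1) 1?mulrC // => i; rewrite dt mulrC.
have [||||||N [g [al [N0 Sg _ eN _]]]] := @constant_extension_trace E S x t delta 0
  (fun=> 1) (fun=> t) t (delta a / a) ch0 sfS deltaD deltaS xtr dx talg.
- by case.
- by case.
- by case.
- exact: gen_mem1.
- by apply: (subfield_div sfS) => //; apply: deltaS.
- by rewrite big_ord0 addr0.
exists 1%N, (fun=> - N%:R), (fun=> a), g; split.
- move=> _; split=> //; last exact: alg_base.
  exact: (subfieldN sfC).
- exact: alg_base.
- by move: eN; rewrite big_ord0 big_ord1 addr0 => ->; rewrite mulNr subrr.
apply: NNPP => /allP ez.
have Cy : C (g - N%:R * t).
  apply: dC => i; have := ez i; rewrite big_ord1 (dD i).1 derivationN //.
  by rewrite (dD i).2 dN mul0r add0r dt mulNr.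
have := nS ((g - (g - N%:R * t)) / N%:R) 1%N isT.
rewrite opprB addrC subrK mulrAC divff ?one_lt // mul1r expr1 eqxx => H.
suff : false by []. apply: H.
rewrite -[t](mulKf (one_lt N N0)) -[N%:R * t](subKr g) mulrC.
apply: (subfield_div sfS); last exact/CS.
by apply: (subfieldB sfS) => //; apply: CS.
Qed.

End Steps.

(** * Constants of a primitive extension, and the total derivation *)

Lemma mem_mkseqP (T : eqType) (g : nat -> T) n x :
  reflect (exists2 k, (k < n)%N & x = g k) (x \in mkseq g n).
Proof.
by apply: (iffP mapP) => -[k]; rewrite ?mem_iota => lt ->; exists k; rewrite ?mem_iota.
Qed.

Lemma adjoin_subfield (K E : fieldType) (iota : {rmorphism K -> E}) (ts : seq E) :
  subfield (adjoin iota ts).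
Proof.
split=> [|x y Ax Ay||]; [|by apply: adjoin_add => //; apply: adjoin_opp
  |exact: adjoin_mul|exact: adjoin_inv].
by rewrite -(rmorph1 iota); apply: adjoin_base.
Qed.

Lemma adjoin_min (K E : fieldType) (iota : K -> E) (ts : seq E) (T : E -> Prop) :
  subfield T -> (forall z, T (iota z)) -> (forall t, t \in ts -> T t) ->
  forall x, adjoin iota ts x -> T x.
Proof.
move=> sfT Tz Tt x; elim=> {x} [||x y _ Tx _ Ty|x _ Tx|x y _ Tx _ Ty|x _ Tx] //.
- exact: (subfieldD sfT).
- exact: (subfieldN sfT).
- exact: (subfieldM sfT).
- exact: (subfieldV sfT).
Qed.

Lemma relation_mono (I : Type) (E : fieldType) (d : I -> E -> E) delta (C S T : E -> Prop) :
  (forall x, S x -> T x) ->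
  nontrivial_relation d delta C S -> nontrivial_relation d delta C T.
Proof.
move=> ST [m [c [w [v [Hk va rel nz]]]]]; exists m, c, w, v; split=> //.
  by move=> k; have [Ck wk wa] := Hk k; split=> //; apply: alg_mono wa.
exact: alg_mono va.
Qed.

(** If the [d i] kill a polynomial in t of positive degree, its top two coefficients yield an
    element of [S] with the same derivatives as t. If they kill p/q, they kill its polynomial part,
    which is then some g0 in [S]; when p/q differs from g0, the inverse of p/q - g0 is also killed
    and has a polynomial part of positive degree. *)
Lemma gen_constant (I : Type) (E : fieldType) (S : E -> Prop) (t : E) (d : I -> E -> E) :
  [pchar E] =i pred0 -> subfield S -> (forall i, derivation (d i)) ->
  (forall i y, S y -> S (d i y)) -> ~ algebraic_over S t -> (forall i, S (d i t)) ->
  ~ (exists2 a, S a & forall i, d i a = d i t) ->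
  forall x, gen S [:: t] x -> (forall i, d i x = 0) -> S x.
Proof.
move=> ch0 sfS dD dS ttr dt noa; have [K [io imS]] := subfield_image sfS.
have Si a : S (io a) by apply/imS; exists a.
pose ev p := (map_poly io p).[t].
have tr := transc_image imS ttr.
have sfA : subfield (fun _ : E => True) by [].
have dT i := derivation_der_on (fun _ : E => True) (dD i).
have exD i := restrict_der imS (dS i).
have exb i : exists b, d i t = io b + io 0 * t.
  by have /imS[b ->] := dt i; exists b; rewrite rmorph0 mul0r addr0.
have ev0 p : (ev p == 0) = (p == 0) by apply: ev_eq0 tr p.
have size1 g : (forall i, d i (ev g) = 0) -> (size g <= 1)%N.
  move=> dg; rewrite leqNgt; apply/negP => lt1; apply: noa.
  have [s es] : exists s, size g = s.+2 by case: (size g) lt1 => [|[|s]] // _; exists s.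
  have l0 : g`_s.+1 != 0 by rewrite -[s.+1]/(s.+2.-1) -es -lead_coefE lead_coef_eq0
    -size_poly_gt0 es.
  have s0 : s.+1%:R != 0 :> K by apply: pchar0_natr (pchar0_morph io ch0) _.
  (* By coefficients s+1 and s of the derivative, g_(s+1) is constant and d g_s + (s+1) g_(s+1) d t
     = 0. *)
  exists (io (- (g`_s / (g`_s.+1 *+ s.+1)))) => // i.
  have [Di DE] := exD i; have [b eb] := exb i.
  have Dd := restrict_derivation (dT i) (fun=> Logic.I) DE.
  have := dg i;
    rewrite /ev (der_ev sfA (dT i) (fun=> Logic.I) Logic.I DE eb) => /tr /polyP eg.
  have := eg s.+1; have := eg s;
    rewrite !(coef_poly_der _ _ (dT i) (fun=> Logic.I) DE) coef0.
  rewrite (nth_default _ (_ : size g <= s.+2)%N) ?es // mul0rn mulr0 !mul0r !addr0 coef0.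
  move=> e1 e2; rewrite DE (derivationN Dd) eb rmorph0 mul0r addr0; congr (io _).
  have DT := derivation_der_on (fun _ : K => True) Dd.
  have sfK : subfield (fun _ : K => True) by [].
  have l1 : g`_s.+1 *+ s.+1 != 0 by rewrite -mulr_natr mulf_neq0.
  rewrite (der_div sfK DT) //.
  have -> : Di (g`_s.+1 *+ s.+1) = 0 by rewrite -mulr_natl Dd.2 (der_nat sfK DT) e2 mul0r
    mulr0 addr0.
  move: e1 => /eqP; rewrite addr_eq0 => /eqP ->.
  by rewrite mulr0 subr0; move: (_ *+ _) l1 => L L0; field.
have d_div p q : q != 0 -> (forall i, d i (ev p / ev q) = 0) -> forall i, d i (ev (p %/
  q)) = 0.
  move=> q0 dpq i; have [Di DE] := exD i; have [b eb] := exb i.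
  have := small_der tr sfA (dT i) (fun=> Logic.I) Logic.I DE eb (small_polynomial_part tr
    p q0).
  rewrite (derB sfA (dT i)) // dpq sub0r (der_ev sfA (dT i) (fun=> Logic.I) Logic.I DE eb).
  by rewrite -hornerN -rmorphN => /(small_ev tr)/eqP; rewrite oppr_eq0 /ev => /eqP ->;
    rewrite rmorph0 horner0.
move=> x /(gen1_frac imS)[p [q [q0 ->]]] dx; rewrite -/(ev p) -/(ev q) in q0 dx *.
rewrite ev0 in q0; have /size1_polyC eg := size1 _ (d_div p q q0 dx).
set g0 := _`_0 in eg; set r := p %% q.
have ep : ev p = io g0 * ev q + ev r.
  by rewrite {1}(divp_eq p q) eg /ev rmorphD rmorphM hornerD hornerM /= map_polyC hornerC.
have [r0|r0] := eqVneq r 0.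
  by rewrite ep r0 {2}/ev rmorph0 horner0 addr0 mulfK ?ev0.
(* q/r is the inverse of p/q - g0, while deg r < deg q makes its polynomial part nonconstant in
   t. *)
have : (size (q %/ r)%R <= 1)%N.
  apply: size1; apply: (d_div) => // i.
  have eyr : ev p / ev q - io g0 = ev r / ev q by rewrite ep; field; rewrite ev0.
  have -> : ev q / ev r = (ev p / ev q - io g0)^-1 by rewrite eyr invf_div.
  have dg0 : d i (io g0) = 0.
    have -> : io g0 = ev g0%:P by rewrite /ev map_polyC hornerC.
    by rewrite -eg; apply: d_div.
  have y0 : ev p / ev q - io g0 != 0.
    by rewrite eyr mulf_neq0 ?invr_eq0 ?ev0.
  by rewrite -[_^-1]div1r (der_div sfA (dT i)) // (der1 sfA (dT i)) (derB sfA (dT i)) //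
    dx dg0 subrr mulr0 mul0r subrr mul0r.
have lt_rq : (size r < size q)%N by rewrite ltn_modp.
rewrite size_divp //; move: lt_rq; rewrite -size_poly_gt0 in r0.
move: (size q) (size r) r0 => a b; lia.
Qed.

Section TotalDerivation.

Variables (F : fieldType) (n : nat) (f : 'I_n -> {mpoly F[n]}) (E : fieldType).
Variables (j : ratfun F n -> E) (d : 'I_n.+1 -> E -> E).
Hypothesis dD : forall i, derivation (d i).

Lemma total_derivation_der : derivation (total_derivation f j d).
Proof.
split=> x y; rewrite /total_derivation.
  rewrite (dD _).1 addrACA -big_split; congr (_ + _); apply: eq_bigr => i _.
  by rewrite (dD _).1 mulrDr.
rewrite (dD _).2 mulrDl mulrDr addrACA mulr_suml mulr_sumr -big_split; congr (_ + _).
by apply: eq_bigr => i _; rewrite (dD _).2 /=; ring.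
Qed.

Lemma total_derivation_lin x y a :
  (forall i, d i x = a * d i y) -> total_derivation f j d x = a * total_derivation f j d y.
Proof.
move=> H; rewrite /total_derivation H mulrDr mulr_sumr; congr (_ + _).
by apply: eq_bigr => i _; rewrite H mulrCA.
Qed.

Lemma total_derivation_form m (c w : 'I_m -> E) v :
  total_derivation f j d v + \sum_k c k * dlog (total_derivation f j d) (w k) =
  (d ord0 v + \sum_k c k * dlog (d ord0) (w k)) +
  \sum_(i < n) j (tofrac (f i)) *
     (d (lift ord0 i) v + \sum_k c k * dlog (d (lift ord0 i)) (w k)).
Proof.
have -> : \sum_(i < n) j (tofrac (f i)) *
      (d (lift ord0 i) v + \sum_k c k * dlog (d (lift ord0 i)) (w k)) =
    \sum_(i < n) j (tofrac (f i)) * d (lift ord0 i) v +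
    \sum_k \sum_(i < n) j (tofrac (f i)) * (c k * dlog (d (lift ord0 i)) (w k)).
  rewrite [X in _ = _ + X]exchange_big -big_split; apply: eq_bigr => i _ /=.
  by rewrite mulrDr mulr_sumr.
rewrite addrACA -big_split; congr (_ + _); apply: eq_bigr => k _ /=.
rewrite /dlog mulrDl mulr_suml mulrDr mulr_sumr; congr (_ + _).
by apply: eq_bigr => i _; ring.
Qed.

End TotalDerivation.

Record subring (E : fieldType) (P : E -> Prop) : Prop := Subring {
  subring1 : P 1;
  subringB : forall x y, P x -> P y -> P (x - y);
  subringM : forall x y, P x -> P y -> P (x * y) }.

Section SubringTheory.

Variables (E : fieldType) (P : E -> Prop) (rP : subring P).

Lemma subring0 : P 0.
Proof. by rewrite -(subrr 1); apply: (subringB rP); apply: (subring1 rP). Qed.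

Lemma subringD x y : P x -> P y -> P (x + y).
Proof.
move=> Px Py; rewrite -[y]opprK; apply: (subringB rP) => //.
by rewrite -sub0r; apply: (subringB rP) => //; apply: subring0.
Qed.

Lemma subring_sum (I : Type) (r : seq I) (Q : pred I) (G : I -> E) :
  (forall i, Q i -> P (G i)) -> P (\sum_(i <- r | Q i) G i).
Proof. by move=> H; elim/big_rec: _ => [|i x Qi]; [exact: subring0|apply: subringD;
  auto]. Qed.

Lemma subring_prod (I : Type) (r : seq I) (Q : pred I) (G : I -> E) :
  (forall i, Q i -> P (G i)) -> P (\prod_(i <- r | Q i) G i).
Proof.
by move=> H; elim/big_rec: _ => [|i x Qi]; [exact: (subring1 rP)|apply: (subringM rP);
  auto].
Qed.

Lemma subringX x k : P x -> P (x ^+ k).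
Proof.
move=> Px; elim: k => [|k IH]; first by rewrite expr0; apply: (subring1 rP).
by rewrite exprS; apply: (subringM rP).
Qed.

Lemma subring_nat k : P k%:R.
Proof.
elim: k => [|k IH]; first exact: subring0.
by rewrite -addn1 natrD; apply: subringD => //; apply: (subring1 rP).
Qed.

End SubringTheory.

(** * The triangular system *)

Section Triangular.

Variables (F : fieldType) (charF0 : [pchar F] =i pred0) (delta : F -> F).
Hypotheses (delta_der : derivation delta) (delta_closed : const_closed delta).
Variable n : nat.
Variables (D : 'I_n.+1 -> ratfun F n -> ratfun F n) (f : 'I_n -> {mpoly F[n]}).
Hypotheses (D_spec : Delta_spec delta D).
Hypothesis f_vars : forall i : 'I_n, in_first_vars i (f i).
Hypothesis no_new : no_new_const delta D f.

Variables (E : fieldType) (j : {rmorphism ratfun F n -> E}) (d : 'I_n.+1 -> E -> E).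
Hypothesis dD : forall i, derivation (d i).
Hypothesis dj : forall i z, d i (j z) = j (D i z).

Local Notation dE := (total_derivation f j d).
Local Notation dK := (total_derivation f id D).

Definition cst_morph : F -> E := j \o (@tofrac {mpoly F[n]} \o @mpolyC n F).
HB.instance Definition _ := GRing.RMorphism.on cst_morph.

Definition baseF (x : E) : Prop := exists z, x = cst_morph z.
Definition constF (x : E) : Prop := exists2 z, delta z = 0 & x = cst_morph z.
Definition baseK (x : E) : Prop := exists z, x = j z.
(* Yn l is y_(l+1), and 0 when l >= n; first_vars l and poly_vars l are the
   images in E of F(y_1, ..., y_l) and F[y_1, ..., y_l]. *)
Definition Yn (l : nat) : E := if insub l is Some i then j (ratX F i) else 0.
Definition first_vars (l : nat) : E -> Prop := gen baseF (mkseq Yn l).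

Fixpoint poly_vars (l : nat) (x : E) : Prop :=
  if l is l'.+1 then
    exists2 g : {poly E}, forall i, poly_vars l' g`_i & x = g.[Yn l']
  else baseF x.

Lemma cst_morphE c : cst_morph c = j (ratC n c).
Proof. by []. Qed.

Lemma charE0 : [pchar E] =i pred0.
Proof. by move=> p; rewrite (fmorph_pchar cst_morph). Qed.

Let dED : derivation dE := total_derivation_der f j dD.
Let dET T : der_on T dE := derivation_der_on T dED.
Let dT T i : der_on T (d i) := derivation_der_on T (dD i).
Let sfA : subfield (fun _ : E => True). Proof. by []. Qed.

Lemma dE_j z : dE (j z) = j (dK z).
Proof.
rewrite /total_derivation dj rmorphD rmorph_sum; congr (_ + _).
by apply: eq_bigr => i _; rewrite dj rmorphM.
Qed.

Lemma dK_C c : dK (ratC n c) = ratC n (delta c).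
Proof.
have [_ H0 _ H1 _] := D_spec; rewrite /total_derivation H0 big1 ?addr0 // => i _.
by rewrite H1 mulr0.
Qed.

Lemma dE_F c : dE (cst_morph c) = cst_morph (delta c).
Proof. by rewrite !cst_morphE dE_j dK_C. Qed.

Lemma dE_Y (i : 'I_n) : dE (Yn i) = j (tofrac (f i)).
Proof.
have [_ _ H0 _ H1] := D_spec; rewrite /Yn valK dE_j /total_derivation H0 add0r.
congr (j _); rewrite (bigD1 i) //= H1 eqxx mulr1 big1 ?addr0 // => k ki.
by rewrite H1 eq_sym (negPf ki) mulr0.
Qed.

Lemma d_Y (i k : 'I_n) : d (lift ord0 i) (Yn k) = (k == i)%:R.
Proof. by have [_ _ _ _ H1] := D_spec; rewrite /Yn valK dj H1 rmorph_nat. Qed.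

Lemma d_F (i : 'I_n) x : baseF x -> d (lift ord0 i) x = 0.
Proof. by have [_ _ _ H1 _] := D_spec => -[z ->]; rewrite cst_morphE dj H1 rmorph0. Qed.

Lemma baseF_subfield : subfield baseF.
Proof. exact: (image_subfield (iota := cst_morph)). Qed.

Lemma constF_subfield : subfield constF.
Proof.
have dF := derivation_der_on (fun _ : F => True) delta_der.
have sfF : subfield (fun _ : F => True) by [].
split=> [|x y [a da ->] [b db ->]|x y [a da ->] [b db ->]|x [a da ->]].
- by exists 1; rewrite ?rmorph1 ?(der1 sfF dF).
- by exists (a - b); rewrite ?rmorphB ?(derB sfF dF) ?da ?db ?subrr.
- by exists (a * b); rewrite ?rmorphM ?dF.2 ?da ?db ?mul0r ?mulr0 ?addr0.
- exists a^-1; rewrite ?fmorphV //; have [->|a0] := eqVneq a 0;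
  first by rewrite invr0 (der0 sfF dF).
  have := der_div sfF dF (subfield1 sfF) (I : True) a0.
  by rewrite mul1r (der1 sfF dF) da mul0r mulr0 subrr mul0r.
Qed.

Lemma constF_baseF x : constF x -> baseF x.
Proof. by case=> z _ ->; exists z. Qed.

Lemma constF_dE x : constF x -> dE x = 0.
Proof. by case=> z dz ->; rewrite dE_F dz rmorph0. Qed.

Lemma constF_d x : constF x -> forall i, d i x = 0.
Proof.
move=> Cx i; case: (unliftP ord0 i) => [k|] ->; first exact/d_F/constF_baseF.
case: Cx => z dz ->; have [_ H0 _ _ _] := D_spec.
by rewrite cst_morphE dj H0 dz -cst_morphE rmorph0.
Qed.

Lemma baseK_subfield : subfield baseK.
Proof. exact: (image_subfield (iota := j)). Qed.

Lemma dK_const z : dK z = 0 -> exists2 c, delta c = 0 & z = ratC n c.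
Proof. by move=> /no_new[c dc ->]; exists c. Qed.

(* The coefficients of the minimal polynomial over F(Y) of a constant are
   constants, because differentiating it lowers its degree. *)
Lemma constF_alg x : algebraic_over baseK x -> dE x = 0 -> constF x.
Proof.
move=> /(alg_image (iota := j) (fun=> iff_refl _))/minimal_poly[p [pm px pmin]] dx.
have dK0 : dK 0 = 0 by apply: (fmorph_inj j); rewrite -dE_j !rmorph0 (derivation0 dED).
have dK1 : dK 1 = 0 by apply: (fmorph_inj j);
  rewrite -dE_j rmorph1 rmorph0 (derivation1 dED).
have dp : map_poly dK p = 0.
  have dpx : (map_poly j (map_poly dK p)).[x] = 0.
    have := der_horner sfA (dET _) (p := map_poly j p) (x := x) (fun=> I) I.
    rewrite px (derivation0 dED) dx mulr0 addr0 => e; rewrite [RHS]e; congr (_.[_]).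
    by apply/polyP => i; rewrite !coef_map_id0 ?(derivation0 dED) ?rmorph0 ?dE_j.
  apply/eqP/contraT => /pmin/(_ dpx); rewrite leqNgt => /negP[];
    rewrite -(prednK (_ : 0 < size p)%N) ?size_poly_gt0 ?monic_neq0 //.
  rewrite ltnS; apply/leq_sizeP => i; rewrite leq_eqVlt => /orP[/eqP <-|lt].
    by rewrite coef_map_id0 // -lead_coefE (monicP pm).
  rewrite coef_map_id0 // nth_default //; move: lt.
  by case: (size p).
have [q ep] : exists q : {poly F}, p = map_poly (@tofrac {mpoly F[n]} \o @mpolyC n F) q.
  apply: (@poly_image _ (fun x => exists z, x = ratC n z)) => [z|i]; first by [].
  have := congr1 (fun r : {poly _} => r`_i) dp.
  by rewrite coef_map_id0 // coef0 => /dK_const[c _ ->]; exists c.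
have sq : size q = size p by rewrite ep size_map_poly.
(* F^delta is algebraically closed, so the minimal polynomial has a root z there; by minimality the
   factor X - z is the one that vanishes at x. *)
have [||z dz rz] := delta_closed (p := q).
- rewrite sq ltnNge; apply/negP => /size1_polyC e; move: px pm; rewrite e map_polyC hornerC.
  by rewrite monicE lead_coefC => /eqP; rewrite fmorph_eq0 => /eqP ->;
    rewrite eq_sym oner_eq0.
- move=> i; have := congr1 (fun r : {poly _} => r`_i) dp.
  rewrite coef_map_id0 // coef0 ep coef_map /= -/(ratC n _) dK_C => e.
  apply: (fmorph_inj (@tofrac {mpoly F[n]} \o @mpolyC n F)); by rewrite rmorph0.
exists z => //; have /factor_theorem[r er] : root p (ratC n z) by rewrite ep;
  exact: rmorph_root.
move: px; rewrite er rmorphM hornerM rmorphB /= map_polyX map_polyC hornerXsubC => /eqP.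
rewrite mulf_eq0 subr_eq0 => /orP[/eqP rx|/eqP //].
have r0 : r != 0 by apply: contraTneq pm => r0;
  rewrite er r0 mul0r monicE lead_coef0 eq_sym oner_eq0.
have := pmin r r0 rx; rewrite er size_mul ?polyXsubC_eq0 // size_XsubC.
by rewrite addn2 ltnn.
Qed.

Lemma first_vars_subfield l : subfield (first_vars l).
Proof. exact: gen_subfield. Qed.

Lemma first_vars_baseF l x : baseF x -> first_vars l x.
Proof. exact: gen_base. Qed.

Lemma first_vars_Yn l k : (k < l)%N -> first_vars l (Yn k).
Proof. by move=> lt; apply/gen_mem/mem_mkseqP; exists k. Qed.

Lemma Yn_baseK l : baseK (Yn l).
Proof.
rewrite /Yn; case: insubP => [i _ _|_]; first by exists (ratX F i).
exact: (subfield0 baseK_subfield).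
Qed.

Lemma first_vars_baseK l x : first_vars l x -> baseK x.
Proof.
move: x; apply: gen_min; first exact: baseK_subfield.
  by move=> x [z ->]; exists (ratC n z).
by move=> x /mem_mkseqP[k _ ->]; apply: Yn_baseK.
Qed.

Lemma first_varsS l x : first_vars l.+1 x -> gen (first_vars l) [:: Yn l] x.
Proof.
move: x; apply: gen_min; first exact: gen_subfield.
  by move=> x Fx; apply/gen_base/first_vars_baseF.
move=> x /mem_mkseqP[k]; rewrite ltnS leq_eqVlt => /orP[/eqP ->|lt] ->;
  first exact: gen_mem1.
exact/gen_base/first_vars_Yn.
Qed.

Lemma gen_first_vars_baseK l x : gen (first_vars l) [:: Yn l] x -> baseK x.
Proof.
move: x; apply: gen_min; [exact: baseK_subfield|exact: first_vars_baseK|].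
by move=> x; rewrite inE => /eqP ->; apply: Yn_baseK.
Qed.

Lemma poly_vars_subring l : subring (poly_vars l).
Proof.
have FB := baseF_subfield; elim: l => [|l IH].
  by split; [exact: (subfield1 FB)|exact: (subfieldB FB)|exact: (subfieldM FB)].
split=> [|x y [p Pp ->] [q Pq ->]|x y [p Pp ->] [q Pq ->]].
- exists 1; rewrite ?hornerC // => i; rewrite coefC.
  by case: eqP => _; [exact: (subring1 IH)|exact: (subring0 IH)].
- exists (p - q); rewrite ?hornerE // => i; rewrite coefB;
  apply: (subringB IH (Pp i) (Pq i)).
exists (p * q); rewrite ?hornerM // => i; rewrite coefM; apply: (subring_sum IH) => k _.
exact: (subringM IH (Pp _) (Pq _)).
Qed.

Lemma poly_varsS l x : poly_vars l x -> poly_vars l.+1 x.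
Proof.
move=> Px; exists x%:P; rewrite ?hornerC // => i; rewrite coefC; case: eqP => // _.
exact: (subring0 (poly_vars_subring l)).
Qed.

Lemma poly_vars_baseF l x : baseF x -> poly_vars l x.
Proof. by move=> Fx; elim: l => [//|l IH]; exact: poly_varsS IH. Qed.

Lemma poly_vars_Yn l k : (k < l)%N -> poly_vars l (Yn k).
Proof.
elim: l => // l IH; rewrite ltnS leq_eqVlt => /orP[/eqP ->|/IH]; last exact: poly_varsS.
exists 'X; rewrite ?hornerX // => i; rewrite coefX;
  apply: (subring_nat (poly_vars_subring l)).
Qed.

Lemma poly_vars_first l x : poly_vars l x -> first_vars l x.
Proof.
elim: l x => [|l IH] x; first exact: first_vars_baseF.
move=> [g Pg ->]; apply: (subfield_horner (first_vars_subfield _)).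
  move=> i; move: (IH _ (Pg i)); apply: gen_min; [exact: first_vars_subfield| |].
    exact: first_vars_baseF.
  by move=> y /mem_mkseqP[k lt ->]; apply: first_vars_Yn; apply: leq_trans lt _.
exact: first_vars_Yn.
Qed.

Lemma poly_vars_mpoly l p : in_first_vars l p -> poly_vars l (j (tofrac p)).
Proof.
move=> Hp; have R := poly_vars_subring l; rewrite [p]mpolyE 2!rmorph_sum big_seq.
apply: (subring_sum R) => m mp; rewrite -mul_mpolyC !rmorphM; apply: (subringM R).
  by apply: poly_vars_baseF; exists p@_m.
rewrite mpolyXE_id 2!rmorph_prod; apply: (subring_prod R) => i _.
rewrite !rmorphXn; have [lt|le] := ltnP i l; last by rewrite (Hp m) // expr0;
  apply: (subring1 R).
by apply: (subringX R); have := poly_vars_Yn lt; rewrite /Yn valK.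
Qed.

Lemma baseK_first_vars x : baseK x -> first_vars n x.
Proof.
have P p : first_vars n (j (tofrac p)).
  by apply/poly_vars_first/poly_vars_mpoly => m _ i; rewrite leqNgt ltn_ord.
move=> [z ->]; have [p [q [_ ->]]] := fracE z.
by rewrite fmorph_div; apply: (subfield_div (first_vars_subfield n)).
Qed.

Lemma dE_baseF x : baseF x -> baseF (dE x).
Proof. by move=> [z ->]; exists (delta z); rewrite dE_F. Qed.

Lemma dE_Yn l : (l < n)%N -> poly_vars l (dE (Yn l)).
Proof. by move=> lt; have := dE_Y (Ordinal lt) => /= ->;
  exact: (poly_vars_mpoly (f_vars (i := Ordinal lt))). Qed.

Lemma first_vars_mono k l x : (k <= l)%N -> first_vars k x -> first_vars l x.
Proof.
move=> le; move: x; apply: gen_min; [exact: first_vars_subfield|exact: first_vars_baseF|].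
by move=> y /mem_mkseqP[i lt ->]; apply: first_vars_Yn; apply: leq_trans lt le.
Qed.

Lemma dE_first_vars l x : (l <= n)%N -> first_vars l x -> first_vars l (dE x).
Proof.
move=> le; move: x; apply: (@der_gen_closed _ baseF (fun=> True)) => //.
- exact: first_vars_subfield.
- exact: first_vars_baseF.
- by move=> y /mem_mkseqP[i lt ->]; apply: first_vars_Yn.
- by move=> y /dE_baseF; apply: first_vars_baseF.
move=> y /mem_mkseqP[i lt ->]; apply/(@first_vars_mono i)/poly_vars_first/dE_Yn;
  first exact: ltnW.
exact: leq_trans lt le.
Qed.

Lemma d_first_vars (i : 'I_n) x : first_vars i x -> d (lift ord0 i) x = 0.
Proof.
move: x; apply: (@der_gen_eq0 _ baseF (fun=> True)) => //; first exact: d_F.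
move=> y /mem_mkseqP[k ltk ->]; have := d_Y i (Ordinal (ltn_trans ltk (ltn_ord i)));
  rewrite /= => ->.
by rewrite -val_eqE /= ltn_eqF.
Qed.

(** The derivation delta_(l+1) kills F(y_1, ..., y_l), hence everything algebraic over it, but takes
    the value 1 at [Yn l]. *)
Lemma Yn_transc l : (l < n)%N -> ~ algebraic_over (first_vars l) (Yn l).
Proof.
move=> lt; set i := Ordinal lt; have := d_Y i i; rewrite eqxx => d1 alg.
have : d (lift ord0 i) (Yn l) = 0.
  apply: (@der_alg_eq0 _ (first_vars l) (fun=> True)) => //;
    [exact: charE0|exact: first_vars_subfield|].
  exact: (@d_first_vars i).
by rewrite d1 => /eqP; rewrite oner_eq0.
Qed.

(** At level l+1 put t = [Yn l] and b = delta t, and let h be the polynomial part of g in t. For i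
    >= 1, coefficient i of phi is delta h_i + (i+1) b h_(i+1), so from the top down delta h_i is a
    polynomial in the earlier variables. The induction hypothesis without logarithms gives a
    polynomial with the same derivative, from which h_i differs by an element of F^delta. The
    logarithms enter coefficient 0 only, where the induction hypothesis replaces h_0 by a polynomial
    and the [w k] by elements of F. *)
Lemma polynomial_descent l m (c w : 'I_m -> E) (g phi : E) : (l <= n)%N ->
  (forall k, constF (c k)) -> first_vars l g ->
  (forall k, first_vars l (w k) /\ w k != 0) -> poly_vars l phi ->
  phi = dE g + \sum_k c k * dlog dE (w k) ->
  exists (G : E) (al : 'I_m -> E),
    [/\ poly_vars l G, forall k, baseF (al k) /\ al k != 0
      & phi = dE G + \sum_k c k * dlog dE (al k)].
Proof.
elim: l m c w g phi => [|l IH] m c w g phi le Cc Bg Bw Pphi ephi.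
  exists g, w; split=> //; first exact: gen_nil baseF_subfield _ Bg.
  by move=> k; have [Bwk wk0] := Bw k; split=> //; apply: gen_nil baseF_subfield _ Bwk.
have le' := ltnW le; have ttr := Yn_transc le; set t := Yn l in ttr.
have sfB := first_vars_subfield l; set B := first_vars l in ttr sfB.
have [K [io imB]] := subfield_image sfB.
have Bi a : B (io a) by apply/imB; exists a.
have dB y : B y -> B (dE y) by apply: dE_first_vars.
have [DK DE] := restrict_der imB dB.
have [p Pp ep] := Pphi.
have [pK epK] := poly_image imB (fun i => poly_vars_first (Pp i)).
have Pdt := dE_Yn le; rewrite -/t in Pdt.
have [b eb] : exists b, dE t = io b by apply/imB/poly_vars_first.
have dtE : dE t = io b + io 0 * t by rewrite rmorph0 mul0r addr0.
have exc k : {a | c k = io a}.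
  apply: constructive_indefinite_description; apply/imB/first_vars_baseF/constF_baseF;
    exact: Cc.
have := polynomial_part (transc_image imB ttr) sfA (dET _) (fun=> I) I DE dtE.
move=> /(_ m (fun k => sval (exc k)) w g pK (gen1_frac imB (first_varsS Bg))) [].
- by move=> k; have [Bwk wk0] := Bw k; split=> //; apply/(gen1_frac imB)/first_varsS.
- rewrite -epK -/t -ep ephi; congr (_ + _); apply: eq_bigr => k _.
  by case: (exc k) => a /= ->.
move=> h [al [nn [eh al0 _ _]]].
have R := poly_vars_subring l.
have coefE i : io pK`_i = dE (io h`_i) + io b * (io h`_i.+1 *+ i.+1) +
    (if i is 0%N then \sum_k c k * dlog dE (io (al k)) else 0).
  rewrite {1}eh coefD coefC (coef_poly_der _ _ (dET (fun=> True)) (fun=> I) DE).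
  rewrite mul0r addr0 rmorphD [in LHS]rmorphD rmorphM rmorphMn -DE /=; congr (_ + _).
  case: i => [|i] /=; last by rewrite rmorph0.
  rewrite rmorph_sum; apply: eq_bigr => k _ /=; case: (exc k) => a /= ->.
  by rewrite mul0r addr0 rmorphM fmorph_div -DE.
have Ppi i : poly_vars l (io pK`_i) by have := Pp i; rewrite epK coef_map.
have Pb : poly_vars l (io b) by rewrite -eb.
(* Downward induction on the index, with [k] counting down from above the degree of h. *)
have Ph k i : (size h <= i.+1 + k)%N -> poly_vars l (io h`_i.+1).
  elim: k i => [|k IHk] i; first by rewrite addn0 => le_h;
    rewrite nth_default // rmorph0; apply: subring0.
  rewrite addnS -addSn => /IHk P2.
  have Pd : poly_vars l (dE (io h`_i.+1)).
    have := coefE i.+1; rewrite addr0 => /(canLR (addrK _)) <-.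
    apply: (subringB R) => //; apply: (subringM R) => //.
    by rewrite -mulr_natl; apply: (subringM R) => //; apply: subring_nat.
  have [|||G [al1 [PG _]]] := IH 0%N (fun=> 0) (fun=> 0) (io h`_i.+1) _ le' _ (Bi _) _ Pd.
  - by case.
  - by case.
  - by rewrite big_ord0 addr0.
  rewrite big_ord0 addr0 => eG; rewrite -[io _](subrK G); apply: (subringD R) => //.
  apply/poly_vars_baseF/constF_baseF/constF_alg;
    last by rewrite (derB sfA (dET _)) // eG subrr.
  apply: alg_base; first exact: baseK_subfield.
  apply: (subfieldB baseK_subfield); first exact: first_vars_baseK (Bi _).
  exact: first_vars_baseK (poly_vars_first PG).
have P0 : poly_vars l (io pK`_0 - io b * io h`_1).
  by apply: (subringB R) => //; apply: (subringM R) => //; apply: (Ph (size h));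
    rewrite leq_addl.
have [||G [be [PG Fbe eG]]] := IH m c (fun k => io (al k)) (io h`_0) _ le' Cc (Bi _) _ P0.
- by move=> k; rewrite fmorph_eq0; split; [exact: Bi|exact: al0].
- by rewrite coefE mulr1n; ring.
exists ((map_poly io h).[t] - io h`_0 + G), be; split=> //.
  exists (map_poly io h - (io h`_0)%:P + G%:P); last by rewrite !hornerE.
  move=> i; rewrite coefD coefB coef_map !coefC; case: i => [|i] /=;
    first by rewrite subrr add0r.
  by rewrite subr0 addr0; apply: (Ph (size h)); rewrite leq_addl.
rewrite dED.1 (derB sfA (dET _)) // -addrA -eG.
have /(congr1 (fun q => (map_poly io q).[t])) := eh; rewrite -epK -ep => ->.
rewrite rmorphD hornerD /= (der_ev sfA (dET (fun=> True)) (fun=> I) I DE dtE).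
rewrite map_polyC hornerC /= -[RHS]addrA; congr (_ + _).
have := coefE 0%N; rewrite mulr1n => ->.
rewrite rmorph_sum /=; move: (dE (io h`_0)) => A;
  rewrite -!addrA [X in _ = _ + (_ + X)]addrC subrK addKr.
apply: eq_bigr => k _ /=; case: (exc k) => a /= ->.
by rewrite mul0r addr0 rmorphM fmorph_div -DE.
Qed.

(** On elements algebraic over F every delta_i with i >= 1 vanishes, so delta agrees there with
    delta_0, and a form killed by delta is killed by all the derivations. *)
Lemma relation_base : ~ nontrivial_relation d dE constF (first_vars 0).
Proof.
move=> [m [c [w [v [Hk va rel [i nz]]]]]].
have FB := baseF_subfield.
have d0 k x : algebraic_over (first_vars 0) x -> d (lift ord0 k) x = 0.
  move=> xa; apply: (@der_alg_eq0 _ (first_vars 0) (fun=> True)) => //; [exact: charE0| |].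
    exact: first_vars_subfield.
  by move=> y /(gen_nil FB); apply: d_F.
have form0 k : d (lift ord0 k) v + \sum_k0 c k0 * dlog (d (lift ord0 k)) (w k0) = 0.
  rewrite d0 // add0r big1 // => k0 _; have [_ _ wa] := Hk k0.
  by rewrite /dlog d0 // mul0r mulr0.
case: (unliftP ord0 i) nz => [k|] ->; first by rewrite form0 eqxx.
move: rel; rewrite total_derivation_form [X in _ + X]big1 => [|k _].
  by rewrite addr0 => ->; rewrite eqxx.
by rewrite form0 mulr0.
Qed.

Lemma integral_of_relation l (h v : E) m (c w : 'I_m -> E) : (l < n)%N -> constF h -> h
  != 0 ->
  algebraic_over (first_vars l) v ->
  (forall k, [/\ constF (c k), w k != 0 & algebraic_over (first_vars l) (w k)]) ->
  dE (v + h * Yn l) + \sum_k c k * dlog dE (w k) = 0 ->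
  exists2 u, elementary_integral delta D f u & ~ (exists c0, u = ratC n c0).
Proof.
move=> lt Ch h0 va Hk rel; have sfC := constF_subfield.
have sfB := first_vars_subfield l; set B := first_vars l in sfB va Hk.
have CB x : constF x -> B x by move=> /constF_baseF; apply: first_vars_baseF.
(* Multiplying the relation by -1/h isolates delta y_(l+1). *)
pose h' := - h^-1; have Ch' : constF h' by apply/(subfieldN sfC)/(subfieldV sfC).
have Cc' k : constF (h' * c k) by have [? _ _] := Hk k; apply: (subfieldM sfC).
pose xs := v :: codom w.
have axs y : y \in xs -> algebraic_over B y.
  by rewrite inE => /orP[/eqP ->//|/codomP[k ->]]; have [] := Hk k.
have rel' : dE (h' * v) + \sum_k h' * c k * dlog dE (w k) = dE (Yn l).
  move: rel; rewrite dED.1 !dED.2 (constF_dE Ch) (constF_dE Ch') !mul0r !add0r => rel.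
  have -> : \sum_k h' * c k * dlog dE (w k) = h' * \sum_k c k * dlog dE (w k).
    by rewrite [RHS]mulr_sumr; apply: eq_bigr => k _; rewrite [RHS]mulrA.
  transitivity (h' * (dE v + h * dE (Yn l) + \sum_k c k * dlog dE (w k)) + dE (Yn l)).
    by rewrite /h'; field.
  by rewrite rel mulr0 add0r.
have [||||N [V [W [N0 [BV BW] eN _ _]]]] := trace_gen charE0 sfB axs (dET _)
   (fun y => @dE_first_vars l y (ltnW lt)) (fun k => CB _ (Cc' k)) _ _ _ _ rel'.
- by move=> k; apply: gen_mem; rewrite inE codom_f orbT.
- by move=> k; have [] := Hk k.
- apply: (subfieldM (gen_subfield _ _)); first exact/gen_base/CB.
  by apply: gen_mem; rewrite mem_head.
- exact/poly_vars_first/dE_Yn.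
have R := poly_vars_subring l.
have [|G [al [PG Fal eG]]] := polynomial_descent (ltnW lt) Cc' BV BW _ (esym eN).
  by apply: (subringM R); [exact: subring_nat|exact: dE_Yn].
have [G0 eG0] := first_vars_baseK (poly_vars_first PG).
have [y ey] := Yn_baseK l.
have N0' : N%:R != 0 :> E by apply: pchar0_natr charE0 N0.
have dN : dE N%:R = 0 by apply: (der_nat sfA (dET _)).
(* N is nonzero, G involves only y_1, ..., y_l, and y_(l+1) is transcendental over these, so u is
   not in F. *)
exists (N%:R * y - G0); last first.
  move=> [c0 e]; apply: (Yn_transc lt); apply: alg_base => //.
  rewrite -(mulKf N0' (Yn l)); apply: (subfieldM sfB).
    exact: (subfieldV sfB (subfield_nat sfB N)).
  have -> : N%:R * Yn l = cst_morph c0 + G.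
    by rewrite cst_morphE -e eG0 -rmorphD subrK rmorphM rmorph_nat ey.
  apply: (subfieldD sfB); last exact: poly_vars_first.
  by apply: first_vars_baseF; exists c0.
split=> //.
have exc k : {a | delta a = 0 /\ h' * c k = cst_morph a}.
  by apply: constructive_indefinite_description; have [a da ->] := Cc' k; exists a.
have exal k : {a | al k = cst_morph a}.
  by apply: constructive_indefinite_description; exact: (Fal k).1.
pose a k := sval (exc k); pose b k := sval (exal k).
have ea k : delta (a k) = 0 /\ h' * c k = cst_morph (a k) by rewrite /a; case: (exc k).
have eb k : al k = cst_morph (b k) by rewrite /b; case: (exal k).
have dF := derivation_der_on (fun _ : F => True) delta_der.
exists (\sum_k a k * (delta (b k) / b k)); last first.
  exists 0, m, b, a; split.
  - by move=> k; have := (Fal k).2; apply: contraNneq => e; rewrite eb e rmorph0.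
  - by move=> k; exact: (ea k).1.
  - by rewrite (derivation0 delta_der) addr0.
apply: (fmorph_inj j); rewrite -dE_j rmorphB rmorphM rmorph_nat -eG0 -ey -cst_morphE.
rewrite (derB sfA (dET _)) // dED.2 dN mul0r add0r eG addrC addKr.
rewrite rmorph_sum; apply: eq_bigr => k _.
by rewrite (ea k).2 eb rmorphM fmorph_div /dlog dE_F.
Qed.

(** Each variable is a primitive over the earlier ones. When h = 0 the same form lives one variable
    lower; as [relation_base] forbids reaching the bottom, some variable has h nonzero, and there
    the form contains h y_(l+1). *)
Lemma integral_of_triangular_relation l : (l <= n)%N ->
  nontrivial_relation d dE constF (first_vars l) ->
  exists2 u, elementary_integral delta D f u & ~ (exists c0, u = ratC n c0).
Proof.
elim: l => [|l IH] le; first by move=> /relation_base.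
move=> [m [c [w [v [Hk valg rel [i0 nz]]]]]].
have mono x : algebraic_over (first_vars l.+1) x ->
    algebraic_over (gen (first_vars l) [:: Yn l]) x.
  by apply: alg_mono; apply: first_varsS.
have Cc k : constF (c k) by have [] := Hk k.
have w0 k : w k != 0 by have [] := Hk k.
have walg k : algebraic_over (gen (first_vars l) [:: Yn l]) (w k) by have [_ _ /mono] :=
  Hk k.
have constC y : algebraic_over (gen (first_vars l) [:: Yn l]) y -> dE y = 0 -> constF y.
  by move=> ya; apply: constF_alg; apply: alg_mono ya; apply: gen_first_vars_baseK.
have [h [v' [m' [c' [w' [Ch ev va H1 H2]]]]]] := descent_primitive charE0
  (first_vars_subfield l) constF_subfield (fun x Cx => first_vars_baseF l (constF_baseF Cx))
  dED constF_dE (fun y => @dE_first_vars l y (ltnW le)) (Yn_transc le) constC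
  Cc w0 walg (mono _ valg) rel (poly_vars_first (dE_Yn le)).
have [h0|h0] := eqVneq h 0.
  move: ev; rewrite h0 mul0r addr0 => ev; subst v'.
  apply: (IH (ltnW le)); exists m', c', w', v; split=> //; first by rewrite -H2.
  by exists i0; rewrite -H2.
apply: (integral_of_relation le Ch h0 va H1); by rewrite -ev -H2.
Qed.

Lemma integral_of_elementary (ts : seq E) e :
  same_set j (common_const D) (common_const d) ->
  (forall x, adjoin j ts x) ->
  (forall k, (k < size ts)%N -> elementary_step d (adjoin j (take k ts)) ts`_k) ->
  dE e = 0 -> ~ constF e ->
  exists2 u, elementary_integral delta D f u & ~ (exists c0, u = ratC n c0).
Proof.
move=> consts gents steps de nCe; pose A k := adjoin j (take k ts).
have sfAk k : subfield (A k) by apply: adjoin_subfield.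
(* Common constants come from F(Y), where delta kills them too, hence from F^delta. *)
have dC x : (forall i, d i x = 0) -> constF x.
  move=> dx; have /consts[z Dz ->] : common_const d x by [].
  have [c dc ->] : exists2 c, delta c = 0 & z = ratC n c; last by exists c.
  by apply: dK_const; rewrite /total_derivation Dz big1 ?addr0 // => i _; rewrite Dz mulr0.
have KA k x : baseK x -> A k x by move=> [z ->]; apply: adjoin_base.
have AK x : A 0%N x -> baseK x.
  by rewrite /A take0; apply: adjoin_min => //; [exact: baseK_subfield|move=> z; exists z].
have mem_take k t : (k < size ts)%N ->
    (t \in take k.+1 ts) = (t == ts`_k) || (t \in take k ts).
  by move=> lt; rewrite (take_nth 0 lt) mem_rcons inE.
have AS k x : (k < size ts)%N -> A k.+1 x -> gen (A k) [:: ts`_k] x.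
  move=> lt; apply: adjoin_min => [|z|t]; first exact: gen_subfield.
    exact/gen_base/adjoin_base.
  rewrite mem_take // => /orP[/eqP ->|tk]; first exact: gen_mem1.
  exact/gen_base/adjoin_gen.
have At k : (k < size ts)%N -> A k.+1 ts`_k.
  by move=> lt; apply: adjoin_gen; rewrite mem_take // eqxx.
have mon k x : (k < size ts)%N -> A k x -> A k.+1 x.
  move=> lt; apply: adjoin_min => [|z|t tk]; [exact: sfAk|exact: adjoin_base|].
  by apply: adjoin_gen; rewrite mem_take // tk orbT.
have SA k x : (k < size ts)%N -> gen (A k) [:: ts`_k] x -> A k.+1 x.
  move=> lt; move: x; apply: gen_min => [|x|x]; [exact: sfAk|exact: mon|].
  by rewrite inE => /eqP ->; apply: At.
have CA k x : constF x -> A k x by move=> [z _ ->]; apply: KA; exists (ratC n z).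
have dEA k : (k <= size ts)%N -> forall x, A k x -> A k (dE x).
  elim: k => [|k IH] lt x; first by move=> /AK[z ->]; apply: KA; exists (dK z);
    rewrite dE_j.
  have {}IH y : A k y -> A k.+1 (dE y) by move=> Ay; apply: mon => //; apply: IH => //;
    apply: ltnW.
  have {}mon y : A k y -> A k.+1 y by apply: mon.
  move=> /(AS _ _ lt); move: x; apply: (@der_gen_closed _ (A k) (fun=> True)) => //.
  - by move=> y; rewrite inE => /eqP ->; apply: At.
  move=> y; rewrite inE => /eqP ->; have [a Aa [ta|dt|[a0 dt]]] := steps k lt.
  - by apply: (@der_alg_mem _ (A k) (fun=> True)) => //;
    [exact: charE0|move=> z /mon|exact: At].
  - rewrite (total_derivation_lin f j (a := ts`_k) (y := a)) => [|i];
    last by rewrite dt mulrC.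
    by apply: (subfieldM (sfAk _)); [exact: At|exact: IH].
  rewrite (total_derivation_lin f j (a := a^-1) (y := a)) => [|i]; last by rewrite dt mulrC.
  by apply: (subfieldM (sfAk _)); [exact/(subfieldV (sfAk _))/mon|exact: IH].
(* No new constant, even among the elements algebraic over the level. This holds at level 0, passes
   to lower levels and fails at the top, so there is a level where it is lost. *)
pose H k := forall y, algebraic_over (A k) y -> dE y = 0 -> constF y.
have H0 : H 0%N by move=> y ya; apply: constF_alg; apply: alg_mono ya; exact: AK.
have HS k : (k < size ts)%N -> H k.+1 -> H k.
  by move=> lt Hk1 y ya; apply: Hk1; apply: alg_mono ya => x; apply: mon.
have nH : ~ H (size ts).
  by move=> /(_ e) He; apply: nCe; apply: He => //; apply: alg_base;
    rewrite ?take_size /A ?take_size.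
have [k [lt Hk nHk]] : exists k, [/\ (k < size ts)%N, H k & ~ H k.+1].
  apply: NNPP => no; apply: nH; suff Hle k : (k <= size ts)%N -> H k by apply: Hle.
  elim: k => // k IH lt; apply: NNPP => nHk; apply: no; exists k; split=> //.
  by apply: IH; apply: ltnW.
have lin x y a : (forall i, d i x = a * d i y) -> dE x = a * dE y by apply:
  total_derivation_lin.
have relk : nontrivial_relation d dE constF (A k).
  have [x xa [dx nCx]] : exists2 x, algebraic_over (A k.+1) x & dE x = 0 /\ ~ constF x.
    apply: NNPP => no; apply: nHk => x xa dx; apply: NNPP => nCx; apply: no.
    by exists x; [|split].
  have xa' : algebraic_over (gen (A k) [:: ts`_k]) x by apply: alg_mono xa => y; apply: AS.
  exact: (new_constant_relation charE0 dD dED lin constF_subfield constF_d dC (sfAk k)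
    (CA k) (dEA k (ltnW lt)) (steps k lt) Hk xa' dx nCx).
have rel0 i : (i <= k)%N -> H i -> nontrivial_relation d dE constF (A i) ->
    nontrivial_relation d dE constF (A 0%N).
  elim: i => // i IH le Hi rel; have lti : (i < size ts)%N by apply: ltn_trans lt.
  apply: IH; [exact: ltnW|exact: HS|].
  apply: (relation_descent charE0 dD dED lin constF_subfield constF_d (sfAk i)
    (CA i) (dEA i (ltnW lti)) (steps i lti)).
    by move=> y ya; apply: Hi; apply: alg_mono ya => z; apply: SA.
  apply: relation_mono rel => y; exact: AS.
apply: (integral_of_triangular_relation (leqnn n)).
apply: relation_mono (rel0 k (leqnn k) Hk relk) => y /AK.
exact: baseK_first_vars.
Qed.

(** Variables are removed from the last one down. With the single derivation delta_(l+1), hence the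
    index type [unit], [gen_constant] applies: this derivation kills F(y_1, ..., y_l), so nothing
    there has derivative 1. *)
Lemma baseF_of_d_eq0 x : baseK x -> (forall i : 'I_n, d (lift ord0 i) x = 0) -> baseF x.
Proof.
move=> /baseK_first_vars Bx dx; suff H l : (l <= n)%N -> first_vars l x -> baseF x.
  exact: H Bx.
elim: l => [|l IH] lt; first exact: gen_nil baseF_subfield _.
move=> /first_varsS Gx; apply: (IH (ltnW lt)).
pose i := Ordinal lt.
apply: (@gen_constant unit E (first_vars l) (Yn l) (fun=> d (lift ord0 i))) => //.
- exact: charE0.
- exact: first_vars_subfield.
- by move=> _ y /(@d_first_vars i) ->; apply: (subfield0 (first_vars_subfield l)).
- exact: Yn_transc.
- by move=> _; have := d_Y i i; rewrite eqxx => ->;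
  apply: (subfield1 (first_vars_subfield l)).
move=> [a /(@d_first_vars i) da] /(_ tt); have := d_Y i i; rewrite da eqxx => -> /eqP.
by rewrite eq_sym oner_eq0.
Qed.

(** For i >= 1, delta_i kills the v_k and therefore their logarithms; if u - sum c_k log v_k - v_0
    were in F^delta, every such delta_i would kill u, which would put u in F. *)
Lemma first_integral_of_logs (u : ratfun F n) (w v0 : F) m (c v : 'I_m -> F) (t : 'I_m ->
  E) :
  dK u = ratC n w -> (forall k, delta (c k) = 0) ->
  w = \sum_k c k * (delta (v k) / v k) + delta v0 ->
  (forall k i, d i (t k) = j (D i (ratC n (v k)) / ratC n (v k))) ->
  ~ (exists c0, u = ratC n c0) ->
  exists e, dE e = 0 /\ ~ constF e.
Proof.
move=> du dc ew dt nu; pose s := \sum_k cst_morph (c k) * t k.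
have dtv k i : d i (t k) = (cst_morph (v k))^-1 * d i (cst_morph (v k)).
  by rewrite dt cst_morphE dj fmorph_div mulrC.
have ds e : derivation e -> (forall k, e (cst_morph (c k)) = 0) ->
    e s = \sum_k cst_morph (c k) * e (t k).
  move=> eD ec; rewrite derivation_sum //; apply: eq_bigr => k _.
  by rewrite eD.2 ec mul0r add0r.
have dcC k : constF (cst_morph (c k)) by exists (c k).
exists (j u - s - cst_morph v0); split.
  rewrite !(derB sfA (dET _)) // dE_j du -cst_morphE dE_F ds //; last first.
    by move=> k; apply: constF_dE.
  rewrite ew rmorphD rmorph_sum /= -addrA -opprD; apply/eqP; rewrite subr_eq0; apply/eqP.
  congr (_ + _); apply: eq_bigr => k _.
  rewrite rmorphM fmorph_div; congr (_ * _).
  by rewrite (total_derivation_lin f j (dtv k)) dE_F mulrC.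
move=> [c0 _ ec0]; apply: nu.
have [z ez] : baseF (j u).
  apply: baseF_of_d_eq0 => [|i]; first by exists u.
  have -> : j u = cst_morph c0 + cst_morph v0 + s by rewrite -ec0 subrK subrK.
  have bF a : baseF (cst_morph a) by exists a.
  rewrite !(dD _).1 !(d_F i (bF _)) !add0r (ds _ (dD _) (fun k => d_F i (bF _))).
  by rewrite big1 // => k _; rewrite dtv (d_F i (bF _)) !mulr0.
by exists z; apply: (fmorph_inj j); rewrite ez.
Qed.

End Triangular.

(** * Adjunction of logarithms *)

Section FractionExtension.

Variables (I : Type) (E : fieldType) (d : I -> E -> E).
Hypothesis dD : forall i, derivation (d i).

Local Notation E' := {fraction {poly E}}.

Definition frac_const : E -> E' := @tofrac {poly E} \o polyC.
HB.instance Definition _ := GRing.RMorphism.on frac_const.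

Definition frac_var : E' := tofrac 'X.

Lemma frac_ev (p : {poly E}) : (map_poly frac_const p).[frac_var] = tofrac p.
Proof.
elim/poly_ind: p => [|p c IH]; first by rewrite rmorph0 horner0 rmorph0.
by rewrite rmorphD rmorphM /= map_polyX map_polyC !hornerE IH rmorphD rmorphM.
Qed.

Lemma frac_gen x : gen (fun x => exists z, x = frac_const z) [:: frac_var] x.
Proof.
have sfG := gen_subfield (fun x => exists z, x = frac_const z) [:: frac_var].
have [p [q [_ ->]]] := fracE x; rewrite -!frac_ev.
by apply: (subfield_div sfG); apply: (subfield_horner sfG); try exact: gen_mem1;
  move=> i; rewrite coef_map; apply: gen_base; eexists.
Qed.

Lemma frac_transc : ~ algebraic_over (fun x => exists z, x = frac_const z) frac_var.
Proof.
move=> /(alg_image (iota := frac_const) (fun=> iff_refl _))[p p0 /rootP].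
by rewrite frac_ev => /eqP; rewrite tofrac_eq0 (negPf p0).
Qed.

Lemma frac_derivations (b : I -> E) :
  exists d' : I -> E' -> E',
    [/\ forall i, derivation (d' i), forall i z, d' i (frac_const z) = frac_const (d i z)
      & forall i, d' i frac_var = frac_const (b i)].
Proof.
have sfA : subfield (fun _ : E => True) by [].
have dT i := derivation_der_on (fun _ : E => True) (dD i).
pose e i (p : {poly E}) := map_poly (d i) p + b i *: p^`().
have eD i : derivation (e i).
  split=> p q; rewrite /e.
    by rewrite (map_poly_derD sfA (dT i)) // derivD scalerDr addrACA.
  rewrite (map_poly_derM sfA (dT i)) // derivM scalerDr -!mul_polyC; ring.
have ex i : {D | derivation D /\ forall p, D (tofrac p) = tofrac (e i p)}.
  by apply: constructive_indefinite_description; have [D ? ?] := derivation_frac (eD i);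
    exists D.
exists (fun i => sval (ex i)); split=> [i|i z|i]; case: (ex i) => D [DD DE] //=.
  rewrite /frac_const /= DE /e derivC scaler0 addr0; congr tofrac.
  by apply/polyP => k; rewrite coef_map_id0 ?(der0 sfA (dT i)) // !coefC;
    case: eqP => // _; rewrite (der0 sfA (dT i)).
rewrite DE /e derivX -mul_polyC mulr1 (_ : map_poly _ _ = 0) ?add0r //.
apply/polyP => k; rewrite coef_map_id0 ?(der0 sfA (dT i)) // coefX coef0.
exact: (der_nat sfA (dT i)).
Qed.

(* A logarithm of a that already lies in E is reused: a second one would
   differ from it by a new constant. *)
Lemma log_extension a : [pchar E] =i pred0 -> a != 0 ->
  exists (L : fieldType) (k : {rmorphism E -> L}) (d' : I -> L -> L) (t : L),
    [/\ forall i, derivation (d' i), forall i z, d' i (k z) = k (d i z),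
        forall i, d' i t = d' i (k a) / k a,
        forall x, common_const d' x -> exists2 z, common_const d z & x = k z
      & forall x, gen (fun x => exists z, x = k z) [:: t] x].
Proof.
move=> ch0 a0; have [[t dt]|noa] := classic (exists t, forall i, d i t = d i a / a).
  exists E, (idfun : {rmorphism E -> E}), d, t; split=> //= x; first by exists x.
  by apply: gen_base; exists x.
have [d' [d'D d'C d'X]] := frac_derivations (fun i => d i a / a).
exists _, frac_const, d', frac_var; split=> //; last exact: frac_gen.
  by move=> i; rewrite d'X d'C fmorph_div.
move=> x dx; have [z ez] : exists z, x = frac_const z.
  apply: (gen_constant _ _ d'D _ frac_transc _ _ (frac_gen x) dx).
  - by move=> p; rewrite (fmorph_pchar frac_const).
  - exact: (image_subfield (iota := frac_const) (fun=> iff_refl _)).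
  - by move=> i y [z ->]; exists (d i z).
  - by move=> i; exists (d i a / a).
  move=> [y [z ->] dz]; apply: noa; exists z => i.
  by apply: (fmorph_inj frac_const); rewrite /= -d'C dz d'X.
by exists z => // i; apply: (fmorph_inj frac_const); rewrite /= -d'C -ez dx rmorph0.
Qed.

End FractionExtension.

Lemma elementary_step_morph (I : Type) (E L : fieldType) (k : {rmorphism E -> L})
    (d : I -> E -> E) (d' : I -> L -> L) (S : E -> Prop) (T : L -> Prop) t :
  (forall i z, d' i (k z) = k (d i z)) -> (forall x, S x -> T (k x)) ->
  elementary_step d S t -> elementary_step d' T (k t).
Proof.
move=> dk ST [a Sa H]; exists (k a); first exact: ST.
case: H => [[p [p0 Sp pt]]|dt|[a0 dt]].
- apply: Or31; exists (map_poly k p); split.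
  + by rewrite map_poly_eq0.
  + by move=> i; rewrite coef_map; apply: ST.
  + exact: rmorph_root.
- by apply: Or32 => i; rewrite !dk dt rmorphM.
- by apply: Or33; rewrite fmorph_eq0; split=> // i; rewrite !dk dt fmorph_div.
Qed.

Lemma elementary_logs (I : Type) (K : fieldType) (D : I -> K -> K) (vs : seq K) :
  [pchar K] =i pred0 -> (forall i, derivation (D i)) -> (forall v, v \in vs -> v != 0) ->
  exists (E : fieldType) (iota : {rmorphism K -> E}) (d : I -> E -> E),
    elementary_extension D iota d /\
    forall v, v \in vs -> exists t, forall i, d i t = iota (D i v / v).
Proof.
move=> ch0 DD; elim: vs => [|v vs IH] vs0.
  exists K, (idfun : {rmorphism K -> K}), D; split=> //; split=> //.
    by move=> x; split=> [Dx|[z Dz ->]] //; exists x.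
  by exists [::]; split=> // x; apply: (adjoin_base (idfun : {rmorphism K -> K})).
have [|E [iota [d [[dD di dc [ts [gents steps]]] logs]]]] := IH.
  by move=> w wvs; apply: vs0; rewrite inE wvs orbT.
have v0 : v != 0 by apply: vs0; rewrite mem_head.
have [||L [k [d' [t [d'D d'k d't d'c gent]]]]] := @log_extension I E d dD (iota v).
- by move=> p; rewrite (fmorph_pchar iota).
- by rewrite fmorph_eq0.
pose ki : {rmorphism K -> L} := k \o iota.
exists L, ki, d'; split; last first.
  move=> w; rewrite inE => /orP[/eqP ->|/logs[s ds]].
    by exists t => i; rewrite d't d'k di -fmorph_div -rmorph_div ?unitfE ?fmorph_eq0.
  by exists (k s) => i; rewrite d'k ds.
split=> //.
- by move=> i z; rewrite /ki /= d'k di.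
- move=> x; split=> [/d'c[z /dc[y Dy ->] ->]|[z Dz ->] i]; first by exists y.
  by rewrite /ki /= d'k di Dz !rmorph0.
have sub s x : adjoin iota s x -> adjoin ki (map k s) (k x).
  elim=> {x} [z|u us|x y _ Ax _ Ay|x _ Ax|x y _ Ax _ Ay|x _ Ax].
  - exact: (adjoin_base ki).
  - by apply: adjoin_gen; apply: map_f.
  - by rewrite rmorphD; apply: adjoin_add.
  - by rewrite rmorphN; apply: adjoin_opp.
  - by rewrite rmorphM; apply: adjoin_mul.
  - by rewrite fmorphV; apply: adjoin_inv.
have mono s u x : adjoin ki s x -> adjoin ki (rcons s u) x.
  move: x; apply: adjoin_min => [|z|w ws]; [exact: adjoin_subfield|exact: adjoin_base|].
  by apply: adjoin_gen; rewrite mem_rcons inE ws orbT.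
(* When the logarithm was already present, [t] merely repeats an element of the field, and its step
   is still logarithmic. *)
exists (rcons (map k ts) t); split.
  move=> x; move: x (gent x); apply: gen_min; first exact: adjoin_subfield.
    by move=> x [z ->]; apply/mono/sub.
  by move=> x; rewrite inE => /eqP ->; apply: adjoin_gen; rewrite mem_rcons mem_head.
move=> i; rewrite size_rcons size_map ltnS leq_eqVlt nth_rcons size_map.
rewrite -cats1 take_cat size_map => /orP[/eqP ->|lt].
  rewrite ltnn eqxx subnn take0 cats0; exists (k (iota v)); first exact: (adjoin_base ki).
  by apply: Or33; rewrite !fmorph_eq0.
rewrite lt (nth_map 0) // -map_take; apply: elementary_step_morph d'k _ (steps i lt).
exact: sub.
Qed.

Theorem theorem1p1 (F : fieldType) (charF0 : [pchar F] =i pred0)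
    (delta : F -> F) (delta_der : derivation delta)
    (delta_closed : const_closed delta)
    (n : nat) (n_gt0 : (0 < n)%N)
    (D : 'I_n.+1 -> {fraction {mpoly F[n]}} -> {fraction {mpoly F[n]}})
    (D_spec : Delta_spec delta D)
    (f : 'I_n -> {mpoly F[n]})
    (f_vars : forall i : 'I_n, in_first_vars i (f i))
    (no_new : no_new_const delta D f) :
  elementary_first_integral delta D f <->
  exists2 u : {fraction {mpoly F[n]}},
    elementary_integral delta D f u & ~ (exists c : F, u = ratC n c).
Proof.
split.
  move=> [E [j [d [[dD dj consts [ts [gents steps]]] [e [de nCe]]]]]].
  apply: (integral_of_elementary charF0 delta_der delta_closed D_spec f_vars no_new dD dj
    consts gents steps de) => -[c dc ec].
  by apply: nCe; exists c.
move=> [u [_ [w du [v0 [m [v [c [v_neq0 dc ew]]]]]]] nu].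
have DD : forall i, derivation (D i) by have [] := D_spec.
have ratC_neq0 a : a != 0 -> ratC n a != 0.
  by move=> a0; rewrite tofrac_eq0 mpolyC_eq0.
have chK : [pchar {fraction {mpoly F[n]}}] =i pred0.
  move=> p; rewrite -(charF0 p) -(fmorph_pchar (@tofrac {mpoly F[n]} \o @mpolyC n F)) //.
have [|E [j [d [ext logs]]]] := @elementary_logs _ _ D (codom (fun k => ratC n (v k)))
  chK DD.
  by move=> x /codomP[k ->]; apply: ratC_neq0.
have ext_t k : {t | forall i, d i t = j (D i (ratC n (v k)) / ratC n (v k))}.
  by apply: constructive_indefinite_description; apply: logs; apply: codom_f.
have [dD dj _ _] := ext.
have [e [de nCe]] := first_integral_of_logs charF0 D_spec dD dj
  du dc ew (t := fun k => sval (ext_t k)) (fun k => svalP (ext_t k)) nu.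
by exists E, j, d; split=> //; exists e.
Qed.
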